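(* Let $\tau$ be an algebraic integer, $d$ a positive integer, and let $\mathcal D\subset\mathbb Z[\tau]^d$ be a finite digit set with $\mathcal D\cap\tau\mathbb Z[\tau]^d=\{0\}$. Let $\mathsf{mw}(z)$ be the minimal Hamming weight of a $\tau$-adic joint digit representation of $z$ with digits in $\mathcal D$. Assume further that the digit set $\mathcal D$ satisfies $$\forall c\in\mathbb Z[\tau]^d\ \ \exists U\in\mathbb R\ \ \forall z\in\mathbb Z[\tau]^d:\ |\mathsf{mw}(z+c)-\mathsf{mw}(z)|\le U.$$ Let $\mathcal A_I\subset\mathbb Z[\tau]^d$ be a finite set with at least two elements and $0\in\mathcal A_I$ such that $(\tau,\mathcal A_I)$ is an irredundant digit system. Consider the random variable $W_n=\mathsf{mw}(D_n)$, where $D_n$ is a random $\tau$-adic joint digit representation of length $n$ with digits in $\mathcal A_I$, the digits of $D_n$ being independent and identically distributed with uniform distribution on $\mathcal A_I$. Then there exist constants $E,V$, with $V\ne0$, such that $$\mathbb E W_n=En+\mathcal O(1),\qquad \mathbb V W_n=Vn+\mathcal O(1),$$ and $$\frac{W_n-En}{\sqrt{Vn}}$$ is asymptotically normally distributed.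
   Context: For a finite set $\mathcal B\subset\mathbb Z[\tau]^d$ of digits, a $\tau$-adic joint digit representation of $z\in\mathbb Z[\tau]^d$ with digits in $\mathcal B$ is a finite sequence $(b_{L-1},\dots,b_0)$ with $b_j\in\mathcal B$ and $z=\sum_{j=0}^{L-1}b_j\tau^j$; $L$ is its length. Its Hamming weight is the number of nonzero (vector) digits $b_j$. $\mathsf{mw}(z)$ is the minimum of the Hamming weights over all representations of $z$ with digits in $\mathcal D$; the displayed boundedness hypothesis presupposes that $\mathsf{mw}(z)$ is finite (i.e. a representation exists) for all $z\in\mathbb Z[\tau]^d$. $(\tau,\mathcal A_I)$ is an irredundant digit system if an element of $\mathbb Z[\tau]^d$ has at most one representation with digits in $\mathcal A_I$, up to leading zeros. $\mathsf{mw}(D_n)$ means $\mathsf{mw}$ of the element of $\mathbb Z[\tau]^d$ represented by $D_n$. Asymptotically normally distributed means convergence in distribution to the standard normal distribution. *)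

(* Defs.v *)
From HB Require Import structures.
From mathcomp Require Import all_boot all_order all_algebra all_field finmap.
From mathcomp Require Import all_classical all_reals all_analysis.

Set Implicit Arguments.
Unset Strict Implicit.
Unset Printing Implicit Defensive.

Import Order.TTheory GRing.Theory Num.Theory.
Import numFieldNormedType.Exports.

Local Open Scope classical_set_scope.
Local Open Scope ring_scope.

Section DigitSystems.
Variables (tau : algC) (d : nat).

(* The ring Z[tau], as a subset of algC. *)
Definition Zadj : set algC :=
  range (fun p : {poly int} => (map_poly intr p).[tau]).

Definition Zadjv : set 'rV[algC]_d := [set z | forall i, Zadj (z 0 i)].

(* Digit sequences are listed least significant digit first: b_j is the entry
   of index j of the list, and leading zeros are trailing entries. *)
Definition value (b : seq 'rV[algC]_d) : 'rV[algC]_d :=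
  \sum_(j < size b) tau ^+ j *: b`_j.

Definition hamming_weight (b : seq 'rV[algC]_d) : nat :=
  count (fun x => x != 0) b.

Definition representation (B : {fset 'rV[algC]_d}) (z : 'rV[algC]_d)
    (b : seq 'rV[algC]_d) : Prop :=
  {subset b <= B} /\ value b = z.

Definition weight_of (B : {fset 'rV[algC]_d}) (z : 'rV[algC]_d) : pred nat :=
  fun k => `[< exists2 b, representation B z b & hamming_weight b = k >].

(* Takes the junk value 0 when z has no representation. *)
Definition mw (B : {fset 'rV[algC]_d}) (z : 'rV[algC]_d) : nat :=
  if pselect (exists k, weight_of B z k) is left ex then ex_minn ex else 0%N.

(* The default entry of b`_j being 0, two sequences with the same entries at
   all indices are equal up to leading zeros. *)
Definition irredundant (B : {fset 'rV[algC]_d}) : Prop :=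
  forall z a b, Zadjv z -> representation B z a -> representation B z b ->
    forall j, a`_j = b`_j.

End DigitSystems.

Section RandomDigits.
Context {disp : measure_display} {T : measurableType disp} {R : realType}.
Variables (P : probability T R) (X : choiceType).

(* X carries the discrete sigma-algebra. *)
Definition random_element (Y : T -> X) : Prop :=
  forall B : set X, measurable (Y @^-1` B).

Definition mutually_independent n (Y : 'I_n -> T -> X) : Prop :=
  forall (J : {set 'I_n}) (B : 'I_n -> set X),
    P (\bigcap_(j in [set` J]) (Y j @^-1` B j)) =
    (\prod_(j in J) P (Y j @^-1` B j))%E.

Definition uniform_on (A : {fset X}) (Y : T -> X) : Prop :=
  forall b, b \in A -> P (Y @^-1` [set b]) = ((#|` A|%:R)^-1)%:E.

Definition iid_uniform_digits (A : {fset X}) n (D : T -> n.-tuple X) : Prop :=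
  let digit j t := tnth (D t) j in
  [/\ forall t, {subset D t <= A},
      forall j, random_element (digit j),
      mutually_independent digit
    & forall j, uniform_on A (digit j)].

End RandomDigits.

(* The variables may live on different probability spaces. *)
Definition converges_in_distribution (R : realType)
    (disp : nat -> measure_display) (T : forall n, measurableType (disp n))
    (P : forall n, probability (T n) R) (Y : forall n, T n -> R)
    (mu : probability (measurableTypeR R) R) : Prop :=
  forall x : R, {for x, continuous (fun r : R => mu `]-oo, r]%classic)} ->
    P n (Y n @^-1` `]-oo, x]%classic) @[n --> \oo] --> mu `]-oo, x]%classic.

(* Main.v *)
(** Every conjugate of tau has modulus greater than 1: a conjugate of modulus
    less than 1 would bound the conjugates of all representable integers, and
    one of modulus 1 makes the minimal polynomial reciprocal, hence tau a unit,
    which is excluded by the condition on the digits. Adding and subtracting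
    digits therefore only produces carries from a finite set, so that the weight
    W satisfies |W(uv) - W(u) - W(v)| <= K for words u, v over the alphabet A_I.
    Moreover a nonzero carry surviving a long run of zeros is more expensive
    than stopping it, so W(u 0^M v) = W(u) + W(v) for some M.

    The mean is quasi-additive in the length, hence linear up to O(1). The
    error W(uv) - W(u) - W(v) only depends on the letters between the last 0^M
    in u and the first 0^M in v, so it is almost uncorrelated with W(u) and
    W(v): the variance is quasi-additive too. It grows because W is
    negatively correlated with the number of long blocks of zeros.

    For the limit law, a word of length n is cut into k blocks of equal length,
    whose weights are independent with sum W + O(k). They are compared with the
    Gaussian by Lindeberg's method, using the functions Phi((x - t) / sigma) as
    smooth test functions: averaging over one block changes sigma^2 into
    sigma^2 + v, up to a third order error. *)
Require Import Defs.
From HB Require Import structures.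
From mathcomp Require Import all_boot all_order all_algebra all_field finmap.
From mathcomp Require Import all_classical all_reals all_analysis.
From mathcomp Require Import ring lra zify.

Set Implicit Arguments.
Unset Strict Implicit.
Unset Printing Implicit Defensive.

Import Order.TTheory GRing.Theory Num.Theory.
Import numFieldNormedType.Exports.

Local Open Scope classical_set_scope.
Local Open Scope ring_scope.

(** * Conjugates of tau *)

(** Serves to choose one bound valid for all digits, conjugates or carries at once: finitely many
    individual bounds are replaced by their maximum. *)
Lemma seq_nat_bound (T : eqType) (s : seq T) (Q : T -> nat -> Prop) :
  (forall b m n, (m <= n)%N -> Q b m -> Q b n) ->
  (forall b, b \in s -> exists m, Q b m) -> exists m, forall b, b \in s -> Q b m.
Proof.
move=> Qmono; elim: s => [|a s IH] Qs; first by exists 0%N.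
have [m Hm] : exists m, forall b, b \in s -> Q b m.
  by apply: IH => b bs; apply: Qs; rewrite inE bs orbT.
have [n Hn] := Qs a (mem_head _ _).
exists (maxn m n) => b; rewrite inE => /predU1P[->|bs].
  by apply: Qmono Hn; exact: leq_maxr.
by apply: Qmono (Hm b bs); exact: leq_maxl.
Qed.

Lemma algC_nat_bound (x : algC) : exists m, `|x| <= m%:R.
Proof. by exists (Num.bound `|x|); rewrite ltW// archi_boundP. Qed.

Local Notation ev q x := ((map_poly intr q : {poly algC}).[x]).

Lemma int_hornerD (q r : {poly int}) x : ev (q + r) x = ev q x + ev r x.
Proof. by rewrite rmorphD hornerD. Qed.

Lemma int_hornerN (q : {poly int}) x : ev (- q) x = - ev q x.
Proof. by rewrite rmorphN hornerN. Qed.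

Lemma int_hornerM (q r : {poly int}) x : ev (q * r) x = ev q x * ev r x.
Proof. by rewrite rmorphM hornerM. Qed.

Lemma int_hornerX x : ev 'X x = x.
Proof. by rewrite map_polyX hornerX. Qed.

Lemma int_hornerC n x : ev n%:P x = n%:~R.
Proof. by rewrite map_polyC hornerC. Qed.

Definition int_hornerE :=
  (int_hornerD, int_hornerN, int_hornerM, int_hornerX, int_hornerC).

Section IntegerRing.
Variable tau : algC.

Lemma Zadj_int (n : int) : Zadj tau n%:~R.
Proof. by exists n%:P => //; rewrite map_polyC hornerC. Qed.

Lemma Zadj_tau : Zadj tau tau.
Proof. by exists 'X => //; rewrite map_polyX hornerX. Qed.

Lemma ZadjD x y : Zadj tau x -> Zadj tau y -> Zadj tau (x + y).
Proof. by move=> [p _ <-] [q _ <-]; exists (p + q); rewrite // !int_hornerE. Qed.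

Lemma ZadjN x : Zadj tau x -> Zadj tau (- x).
Proof. by move=> [p _ <-]; exists (- p); rewrite // !int_hornerE. Qed.

Lemma ZadjM x y : Zadj tau x -> Zadj tau y -> Zadj tau (x * y).
Proof. by move=> [p _ <-] [q _ <-]; exists (p * q); rewrite // !int_hornerE. Qed.

(** [tau] is a root of the gcd or of its cofactor in [P0], so [P0] divides one of the two. If it
    divides the cofactor, comparing degrees makes the gcd constant. *)
Lemma min_poly_dvd_or_coprime (P0 : {poly rat}) (q : {poly rat}) : P0 != 0 ->
  (forall q, root (map_poly ratr q) tau = (P0 %| q)) ->
  P0 %| q \/ coprimep P0 q.
Proof.
move=> P00 P0P; pose g := gcdp P0 q.
have gP : P0 = P0 %/ g * g by rewrite divpK ?dvdp_gcdl.
have : root (map_poly ratr P0) tau by rewrite P0P.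
rewrite {1}gP rmorphM rootM !P0P => /orP[Ph|Pg]; last first.
  by left; apply: dvdp_trans Pg _; exact: dvdp_gcdr.
right; have h0 : P0 %/ g != 0 by apply: contraNneq P00 => h0; rewrite gP h0 mul0r.
have g0 : g != 0 by apply: contraNneq P00 => g0; rewrite gP g0 mulr0.
have := dvdp_leq h0 Ph; have := size_mul h0 g0; rewrite -gP.
move: h0 g0; rewrite -!size_poly_gt0 /coprimep -/g; lia.
Qed.

Lemma map_ratr_intr (q : {poly int}) :
  map_poly ratr (map_poly intr q : {poly rat}) = map_poly intr q :> {poly algC}.
Proof. by rewrite -map_poly_comp; apply: eq_map_poly => x; rewrite /= ratr_int. Qed.

Hypothesis tau_int : tau \in Aint.

(* The conjugates of tau: q(tau) |-> q(sigma) is well defined on Z[tau]. *)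
Lemma conjugates_exist : exists (p : {poly int}) (rs : seq algC),
  [/\ p \is monic, uniq rs /\ tau \in rs, map_poly intr p = \prod_(z <- rs) ('X - z%:P),
    forall q sigma, sigma \in rs -> ev q tau = 0 -> ev q sigma = 0 &
    forall q sigma, sigma \in rs -> ev q sigma = 0 -> ev q tau = 0].
Proof.
have [P0 [PE P0mon] P0P] := minCpolyP tau.
have P00 := monic_neq0 P0mon.
have [rs Prs] := closed_field_poly_normal (minCpoly tau).
rewrite (monicP (minCpoly_monic tau)) scale1r in Prs.
have dvd_or_coprime q := min_poly_dvd_or_coprime q P00 P0P.
(* The derivative has the degree of [P0] as top coefficient, so it is nonzero, and its degree is
   smaller. It is therefore coprime to [P0], and the roots are distinct. *)
have P0deriv : ~ P0 %| P0^`().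
  have d0 : P0^`() != 0.
    apply/eqP => /(congr1 (fun q : {poly rat} => q`_(size P0).-2)).
    rewrite coef_deriv coef0.
    have := size_minCpoly tau; rewrite PE size_map_poly.
    move: (monicP P0mon); rewrite lead_coefE; case: (size P0) => [|[|n]]//= -> _ /eqP.
    by rewrite pnatr_eq0.
  by move=> /(dvdp_leq d0); rewrite leqNgt lt_size_deriv.
have urs : uniq rs.
  rewrite -separable_prod_XsubC -Prs PE separable_poly.unlock deriv_map coprimep_map.
  by case: (dvd_or_coprime P0^`()).
have [p pE] : exists p : {poly int}, map_poly intr p = minCpoly tau.
  have := tau_int; rewrite unfold_in => /floorpP; case=> p ->; by exists p.
have root_rs sigma : sigma \in rs -> root (map_poly ratr P0) sigma.
  by move=> srs; rewrite -PE Prs root_prod_XsubC.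
exists p, rs; split => //.
- rewrite monicE; apply/eqP/(@intr_inj algC).
  by rewrite -(lead_coef_map_inj (@intr_inj algC))// pE (monicP (minCpoly_monic _)).
- by split => //; rewrite -root_prod_XsubC -Prs root_minCpoly.
- by rewrite pE.
- move=> q sigma srs /rootP qt; apply/rootP; move: qt.
  rewrite -!map_ratr_intr P0P => P0q.
  by rewrite -(divpK P0q) rmorphM rootM root_rs ?orbT.
- move=> q sigma srs /rootP qs; apply/rootP; move: qs; rewrite -!map_ratr_intr P0P => qs.
  case: (dvd_or_coprime (map_poly intr q)) => // co; exfalso; move: co.
  rewrite -(coprimep_map (ratr : {rmorphism rat -> algC})) => /coprimep_root/(_ (root_rs _ srs)).
  by rewrite (rootP qs) eqxx.
Qed.

End IntegerRing.
Section Conjugates.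
Variables (tau : algC) (p : {poly int}) (rs : seq algC).


Hypothesis p_monic : p \is monic.
Hypothesis rs_uniq : uniq rs.
Hypothesis tau_rs : tau \in rs.
Hypothesis p_rs : map_poly intr p = \prod_(z <- rs) ('X - z%:P).
Hypothesis conj_wd : forall q sigma, sigma \in rs -> ev q tau = 0 -> ev q sigma = 0.
Hypothesis conj_inj : forall q sigma, sigma \in rs -> ev q sigma = 0 -> ev q tau = 0.

(** The conjugates of [z] are read off an integer polynomial [q] with q(tau) = z; by [conj_wd_eq]
    they do not depend on the choice of [q]. A natural number as bound suits [seq_nat_bound]. *)
Definition conj_bounded (m : nat) (z : algC) : Prop :=
  exists2 q : {poly int}, ev q tau = z &
    forall sigma, sigma \in rs -> `|ev q sigma| <= m%:R.

Lemma conj_bounded_mono z m n : (m <= n)%N -> conj_bounded m z -> conj_bounded n z.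
Proof.
by move=> mn [q qz qm]; exists q => // s /qm/le_trans; apply; rewrite ler_nat.
Qed.

Lemma conj_wd_eq q q' sigma : sigma \in rs -> ev q tau = ev q' tau -> ev q sigma = ev q' sigma.
Proof.
move=> srs qq; apply/eqP; rewrite -subr_eq0; apply/eqP.
have := @conj_wd (q - q') sigma srs; rewrite !int_hornerE; apply.
by rewrite qq subrr.
Qed.

Lemma Zadj_conj_bounded z : Zadj tau z -> exists m, conj_bounded m z.
Proof.
move=> [q _ qz].
have [||m Hm] := @seq_nat_bound _ rs (fun s m => `|ev q s| <= m%:R).
- by move=> b m n mn h; apply: le_trans h _; rewrite ler_nat.
- by move=> b _; exact: algC_nat_bound.
- by exists m, q.
Qed.

Lemma digits_conj_bounded d (B : {fset 'rV[algC]_d}) : [set` B] `<=` @Zadjv tau d ->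
  exists m, forall b, b \in B -> forall i, conj_bounded m (b 0 i).
Proof.
move=> BZ.
have [||m Hm] := @seq_nat_bound _ (enum_fset B) (fun b m => forall i, conj_bounded m (b 0 i)).
- by move=> b m n mn h i; apply: conj_bounded_mono (h i).
- move=> b bB.
  have [||m Hm] := @seq_nat_bound _ (enum 'I_d) (fun i m => conj_bounded m (b 0 i)).
  + by move=> i m n mn h; apply: conj_bounded_mono h.
  + by move=> i _; apply: Zadj_conj_bounded; apply: BZ.
  + by exists m => i; apply: Hm; rewrite mem_enum.
- by exists m.
Qed.

Lemma value_cons d (x : 'rV[algC]_d) b : value tau (x :: b) = x + tau *: value tau b.
Proof.
rewrite /value /= big_ord_recl /= expr0 scale1r; congr (_ + _).
by rewrite scaler_sumr; apply: eq_bigr => i _; rewrite scalerA -exprS.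
Qed.

(** If |sigma| < 1, a single geometric series dominates the conjugates of all digit sums, whereas a
    rational integer is its own conjugate and can be arbitrarily large. *)
Lemma conj_norm_ge1 d (B : {fset 'rV[algC]_d}) : [set` B] `<=` @Zadjv tau d -> (0 < d)%N ->
  (forall z, Zadjv tau z -> exists b, representation tau B z b) ->
  forall sigma, sigma \in rs -> 1 <= `|sigma|.
Proof.
case: d B => // d B BZ _ rep sigma srs.
rewrite real_leNgt ?normr_real ?rpred1//; apply/negP => s1.
have [m Hm] := digits_conj_bounded BZ.
(* The sum of the geometric series, that is, the fixed point of x |-> m + |sigma| x. *)
pose M' : algC := m%:R / (1 - `|sigma|).
have M'E : m%:R + `|sigma| * M' = M'.
  by rewrite /M'; field; rewrite subr_eq0 gt_eqF.
have val_bound b : {subset b <= B} ->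
    exists2 q, ev q tau = value tau b 0 0 & `|ev q sigma| <= M'.
  elim: b => [|x b IH] bB.
    exists 0; first by rewrite rmorph0 horner0 /value big_ord0 mxE.
    by rewrite rmorph0 horner0 normr0 divr_ge0// subr_ge0 ltW.
  have [q qb qM] : exists2 q, ev q tau = value tau b 0 0 & `|ev q sigma| <= M'.
    by apply: IH => y yb; apply: bB; rewrite inE yb orbT.
  have [r rx rm] := Hm x (bB x (mem_head _ _)) 0.
  exists (r + 'X * q); first by rewrite !int_hornerE value_cons !mxE rx qb.
  rewrite !int_hornerE -M'E; apply: le_trans (ler_normD _ _) _; apply: lerD; first exact: rm.
  by rewrite normrM ler_wpM2l.
have [n] := algC_nat_bound (M' + 1).
have M'0 : 0 <= M' by rewrite divr_ge0// subr_ge0 ltW.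
rewrite ger0_norm ?addr_ge0// => Mn.
have [|b [bB bz]] := rep (const_mx n%:R).
  by move=> i; rewrite mxE; exact: (Zadj_int tau n).
have [q qz qM] := val_bound b bB.
have : ev q sigma = ev (n%:Z%:P) sigma.
  by apply: conj_wd_eq => //; rewrite qz bz mxE map_polyC hornerC.
rewrite map_polyC hornerC => qn; move: qM; rewrite qn ger0_norm ?ler0n// => nM.
have := le_trans Mn nM; rewrite -subr_ge0 opprD addrA subrr sub0r oppr_ge0.
by rewrite ler10.
Qed.

(* Otherwise conj sigma = 1/sigma is a root of p, so tau is a root of the
   reversed polynomial of p, whose constant coefficient is 1. *)
Lemma conj_norm_neq1 sigma : (forall u, Zadj tau u -> tau * u != 1) ->
  sigma \in rs -> `|sigma| != 1.
Proof.
move=> nonunit srs; apply/negP => /eqP s1.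
pose n := (size p).-1.
have sp : size p = n.+1.
  by rewrite prednK// lt0n size_poly_eq0 monic_neq0.
pose q : {poly int} := \poly_(i < n.+1) p`_(n - i).
have szm (r : {poly int}) : size (map_poly intr r : {poly algC}) = size r.
  exact: (size_map_inj_poly (@intr_inj algC)).
have evp (r : {poly int}) k x : (size r <= k)%N -> ev r x = \sum_(i < k) (r`_i)%:~R * x ^+ i.
  move=> rk; rewrite (horner_coef_wide _ (n := k)) ?szm//.
  by apply: eq_bigr => i _; rewrite coef_map.
have sq : (size q <= n.+1)%N by exact: size_poly.
have ps0 : ev p sigma = 0.
  by apply/rootP; rewrite p_rs root_prod_XsubC.
have ssc : sigma * sigma^* = 1 by rewrite -normCK s1 expr1n.
have qs0 : ev q sigma = 0.
  (* On the unit circle the complex conjugate of sigma is its inverse, so reversing the coefficients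
     conjugates p(sigma) up to the factor sigma^n. *)
  have -> : ev q sigma = sigma ^+ n * (ev p sigma)^*.
    rewrite (evp p n.+1) ?sp// (evp q n.+1)// rmorph_sum mulr_sumr.
    rewrite (reindex_inj rev_ord_inj)/=; apply: eq_bigr => i _.
    have ni : (i <= n)%N by rewrite -ltnS.
    rewrite coef_poly subSS ltnS leq_subr subKn// rmorphM rmorph_int rmorphXn/=.
    rewrite mulrCA; congr (_ * _).
    rewrite (_ : sigma ^+ n = sigma ^+ (n - i) * sigma ^+ i); last by rewrite -exprD subnK.
    by rewrite -mulrA -exprMn ssc expr1n mulr1.
  by rewrite ps0 conjC0 mulr0.
have := conj_inj srs qs0; rewrite (evp q n.+1)// big_ord_recl/= expr0 mulr1.
rewrite coef_poly subn0 ltn0Sn.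
have -> : p`_n = 1 by rewrite -(monicP p_monic) lead_coefE sp.
move=> /eqP; rewrite addr_eq0 => /eqP e.
(* Since q(tau) = 0 and [q] has constant coefficient 1, this [u] is an inverse of tau in Z[tau]. *)
pose u := - \sum_(i < n) (q`_i.+1)%:~R * tau ^+ i.
have /negP[] : tau * u != 1.
  apply: nonunit; apply: ZadjN; exists (\poly_(i < n) q`_i.+1) => //.
  rewrite (evp _ n) ?size_poly//; apply: eq_bigr => i _.
  by rewrite coef_poly ltn_ord.
rewrite /u mulrN mulr_sumr; apply/eqP; rewrite [RHS]e; congr (- _).
by apply: eq_bigr => i _; rewrite mulrCA -exprS.
Qed.

(** Modulo [p], an element of Z[tau] is given by n integer coefficients. They are recovered from the
    n conjugates through the inverse Vandermonde matrix, so bounded conjugates leave finitely many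
    choices. *)
Lemma conj_bounded_finite m : exists s : seq algC, forall z, conj_bounded m z -> z \in s.
Proof.
pose n := size rs.
have sp : size p = n.+1.
  by rewrite -(size_map_inj_poly (@intr_inj algC))// p_rs size_prod_XsubC.
pose a : 'rV[algC]_n := \row_j rs`_j.
pose Vm := Vandermonde n a.
have Vu : Vm \in unitmx.
  rewrite unitmxE unitfE det_Vandermonde; apply/prodf_neq0 => i _.
  apply/prodf_neq0 => j ij; rewrite !mxE subr_eq0 nth_uniq// eq_sym.
  by rewrite neq_ltn ij.
have [Bd HBd] := algC_nat_bound (\sum_i \sum_j m%:R * `|invmx Vm j i|).
(* Coefficients between -Bd and Bd, stored with an offset of Bd in a finite ordinal type. *)
pose f (g : {ffun 'I_n -> 'I_(Bd + Bd).+1}) : algC :=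
  \sum_i ((g i)%:Z - Bd%:Z)%:~R * tau ^+ i.
exists [seq f g | g <- enum {ffun 'I_n -> 'I_(Bd + Bd).+1}] => z [q qz qm].
pose r := Pdiv.CommonRing.rmodp q p.
have qr x : ev p x = 0 -> ev r x = ev q x.
  move=> px; rewrite [q in RHS](Pdiv.RingMonic.rdivp_eq p_monic) !int_hornerE px mulr0 add0r.
  by [].
have rootp s : s \in rs -> ev p s = 0.
  by move=> srs; apply/rootP; rewrite p_rs root_prod_XsubC.
have sr : (size r <= n)%N.
  by rewrite -ltnS -sp Pdiv.Ring.ltn_rmodpN0// monic_neq0.
have evr x : ev r x = \sum_(i < n) (r`_i)%:~R * x ^+ i.
  rewrite (horner_coef_wide _ (n := n)) ?(size_map_inj_poly (@intr_inj algC))//.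
  by apply: eq_bigr => i _; rewrite coef_map.
pose c : 'rV[algC]_n := \row_i (r`_i)%:~R.
have cV : c *m Vm = \row_j ev r (rs`_j).
  apply/rowP => j; rewrite !mxE evr; apply: eq_bigr => i _.
  by rewrite !mxE.
have cE : c = (\row_j ev r (rs`_j)) *m invmx Vm by rewrite -cV mulmxK.
have c_bound (i : 'I_n) : `|r`_i| <= Bd%:Z.
  rewrite -(ler_int algC) intr_norm; apply: le_trans HBd.
  have -> : (r`_i)%:~R = c 0 i by rewrite mxE.
  rewrite [leRHS]ger0_norm; last first.
    by apply: sumr_ge0 => ? _; apply: sumr_ge0 => ? _; rewrite mulr_ge0.
  rewrite (bigD1 i)//= -[leLHS]addr0; apply: lerD; last first.
    by apply: sumr_ge0 => ? _; apply: sumr_ge0 => ? _; rewrite mulr_ge0.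
  rewrite cE mxE; apply: le_trans (ler_norm_sum _ _ _) _; apply: ler_sum => j _.
  by rewrite normrM ler_wpM2r// mxE qr ?rootp ?qm// mem_nth.
pose g : {ffun 'I_n -> 'I_(Bd + Bd).+1} := [ffun i : 'I_n => inord `|(r`_i + Bd%:Z)%R|%N].
apply/mapP; exists g; first by rewrite mem_enum.
have gE i : (g i : nat)%:Z - Bd%:Z = r`_i.
  have := c_bound i; rewrite ffunE ler_norml; move: (r`_i : int) => y /andP[y1 y2].
  have y0 : 0 <= y + Bd%:Z by lia.
  rewrite inordK ?gez0_abs//; first by lia.
  by rewrite -ltz_nat gez0_abs//; lia.
rewrite /f -qz -qr ?rootp// evr; apply: eq_bigr => i _.
by rewrite gE.
Qed.

End Conjugates.

(** * Carries and the minimal weight of concatenations *)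

Section Vectors.
Variables (tau : algC) (d : nat).
Implicit Types (z : 'rV[algC]_d) (b : seq 'rV[algC]_d).

Lemma Zadjv0 : Zadjv tau (0 : 'rV[algC]_d).
Proof. by move=> i; rewrite mxE; exact: (Zadj_int tau 0). Qed.

Lemma ZadjvD z1 z2 : Zadjv tau z1 -> Zadjv tau z2 -> Zadjv tau (z1 + z2).
Proof. by move=> h1 h2 i; rewrite mxE; apply: ZadjD. Qed.

Lemma ZadjvN z : Zadjv tau z -> Zadjv tau (- z).
Proof. by move=> h i; rewrite mxE; apply: ZadjN. Qed.

Lemma ZadjvB z1 z2 : Zadjv tau z1 -> Zadjv tau z2 -> Zadjv tau (z1 - z2).
Proof. by move=> h1 h2; apply: ZadjvD => //; exact: ZadjvN. Qed.

Lemma Zadj_exp k : Zadj tau (tau ^+ k).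
Proof.
elim: k => [|k IH]; first by rewrite expr0; exact: (Zadj_int tau 1).
by rewrite exprS; apply: ZadjM => //; exact: Zadj_tau.
Qed.

Lemma Zadjv_exp k z : Zadjv tau z -> Zadjv tau (tau ^+ k *: z).
Proof. by move=> h i; rewrite mxE; apply: ZadjM => //; exact: Zadj_exp. Qed.

Lemma Zadjv_value (B : {fset 'rV[algC]_d}) b :
  [set` B] `<=` @Zadjv tau d -> {subset b <= B} -> Zadjv tau (value tau b).
Proof.
move=> BZ bB; rewrite /value; elim/big_ind: _ => [||i _].
- exact: Zadjv0.
- exact: ZadjvD.
- by apply: Zadjv_exp; apply: BZ; apply: bB; exact: mem_nth.
Qed.

Lemma value_nil : value tau [::] = 0 :> 'rV[algC]_d.
Proof. by rewrite /value big_ord0. Qed.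

Lemma value_cat b1 b2 : value tau (b1 ++ b2) = value tau b1 + tau ^+ size b1 *: value tau b2.
Proof.
elim: b1 => [|x b1 IH]; first by rewrite value_nil add0r expr0 scale1r.
by rewrite cat_cons !value_cons IH scalerDr scalerA exprS addrA.
Qed.

Lemma value_zeros k : value tau (nseq k 0) = 0 :> 'rV[algC]_d.
Proof.
by elim: k => [|k IH]; rewrite ?value_nil//= value_cons IH scaler0 addr0.
Qed.

End Vectors.

Section MinimalWeight.
Variables (tau : algC) (d : nat) (DD AI : {fset 'rV[algC]_d}).
Implicit Types (z c y : 'rV[algC]_d) (b u v : seq 'rV[algC]_d).

Hypothesis DD_Z : [set` DD] `<=` @Zadjv tau d.
Hypothesis DD_rep : forall z, Zadjv tau z -> exists b, representation tau DD z b.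

Local Notation mwD := (mw tau DD).

Lemma mw_le b : {subset b <= DD} -> (mwD (value tau b) <= hamming_weight b)%N.
Proof.
move=> bD; rewrite /mw; case: pselect => // ex.
by case: ex_minnP => m _; apply; apply/asboolP; exists b.
Qed.

Lemma mw_attained z : Zadjv tau z -> exists2 b, representation tau DD z b & hamming_weight b = mwD z.
Proof.
move=> zZ; rewrite /mw; case: pselect => [ex|[]].
  by case: ex_minnP => m /asboolP[b bz bm] _; exists b.
have [b bz] := DD_rep zZ; exists (hamming_weight b).
by apply/asboolP; exists b.
Qed.

Lemma mw0 : mwD 0 = 0%N.
Proof. by apply/eqP; rewrite -leqn0 -{1}(value_nil tau d); apply: leq_trans (mw_le _) _. Qed.

Lemma mw_gt0 z : Zadjv tau z -> z != 0 -> (0 < mwD z)%N.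
Proof.
move=> zZ; have [b [_ bz] <-] := mw_attained zZ; apply: contraR.
rewrite -eqn0Ngt eqn0Ngt -has_count => /hasPn b0.
rewrite -bz /value big1// => i _.
by have := b0 b`_i (mem_nth _ (ltn_ord i)); rewrite negbK => /eqP ->; rewrite scaler0.
Qed.

Hypothesis DD0 : 0 \in DD.

(** Padding an optimal representation with leading zeros changes neither value nor weight, so it can
    be cut at any position, even beyond its length. *)
Lemma mw_split z m : Zadjv tau z -> exists b1 b2,
  [/\ size b1 = m, {subset b1 <= DD}, {subset b2 <= DD},
      z = value tau b1 + tau ^+ m *: value tau b2 &
      mwD z = (hamming_weight b1 + hamming_weight b2)%N].
Proof.
move=> zZ; have [b [bD bz] bw] := mw_attained zZ.
pose b' := b ++ nseq m 0.
have b'D : {subset b' <= DD}.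
  by move=> x; rewrite mem_cat => /orP[/bD//|]; rewrite mem_nseq => /andP[_ /eqP->].
have s1 : size (take m b') = m.
  by rewrite size_take size_cat size_nseq; case: ltnP => //; lia.
exists (take m b'), (drop m b'); split => //.
- by move=> x /mem_take/b'D.
- by move=> x /mem_drop/b'D.
- rewrite -[X in tau ^+ X]s1 -value_cat cat_take_drop /b' value_cat value_zeros.
  by rewrite scaler0 addr0.
- rewrite -bw /hamming_weight -count_cat cat_take_drop count_cat.
  by rewrite count_nseq eqxx mul0n addn0.
Qed.

Hypothesis AI_Z : [set` AI] `<=` @Zadjv tau d.

(** [C] is the set of carries, enumerated by the list [s]; [carry_set_exists] provides both. [U]
    bounds the effect of adding one carry on the minimal weight. *)
Variables (C : set 'rV[algC]_d) (s : seq 'rV[algC]_d) (U : nat).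
Hypothesis C0 : C 0.
Hypothesis C_Z : C `<=` @Zadjv tau d.
Hypothesis C_finite : forall c, C c -> c \in s.
Hypothesis C_carry : forall c a x c', C c -> a \in AI -> x \in DD -> Zadjv tau c' ->
  tau *: c' = c + a - x -> C c'.
Hypothesis C_shift : forall c z, C c -> Zadjv tau z ->
  (mwD (z + c) <= mwD z + U)%N /\ (mwD z <= mwD (z + c) + U)%N.

Lemma mw_carry c : C c -> (mwD c <= U)%N.
Proof. by move=> /C_shift/(_ (@Zadjv0 tau d))[]; rewrite add0r mw0. Qed.

(** Subtracting a word over [DD] from a word over [AI] digit by digit: each step divides the current
    carry plus the digit difference by tau, which stays in [C], and [y] is the last carry. *)
Lemma carry_closed u b c y : C c -> size u = size b -> {subset u <= AI} ->
  {subset b <= DD} -> Zadjv tau y ->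
  c + value tau u = value tau b + tau ^+ size b *: y -> C y.
Proof.
elim: u b c => [|a u IH] [|x b] c Cc //= sub uA bD yZ.
  by rewrite !value_nil addr0 add0r expr0 scale1r => <-.
have uA' : {subset u <= AI} by move=> w wu; apply: uA; rewrite inE wu orbT.
have bD' : {subset b <= DD} by move=> w wu; apply: bD; rewrite inE wu orbT.
rewrite !value_cons exprS -scalerA => e.
(* This is (c + a - x) / tau, written without a division so that it visibly lies in Z[tau]^d. *)
pose c1 := value tau b + tau ^+ size b *: y - value tau u.
apply: (IH b c1) => //; [|by case: sub|by rewrite subrK].
apply: (C_carry Cc (uA a (mem_head _ _)) (bD x (mem_head _ _))).
  apply: ZadjvB; last exact: Zadjv_value uA'.
  by apply: ZadjvD; [exact: Zadjv_value bD' | exact: Zadjv_exp].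
apply/rowP => i; move/rowP: e => /(_ i); rewrite !mxE => e.
rewrite (_ : c 0 i = c 0 i + (a 0 i + tau * value tau u 0 i) - (a 0 i + tau * value tau u 0 i)); last by ring.
by rewrite e; ring.
Qed.

Lemma mw_cat_le b y : {subset b <= DD} -> Zadjv tau y ->
  (mwD (value tau b + tau ^+ size b *: y) <= hamming_weight b + mwD y)%N.
Proof.
move=> bD yZ; have [b2 [b2D <-] <-] := mw_attained yZ.
rewrite -value_cat /hamming_weight -count_cat; apply: mw_le => x.
by rewrite mem_cat => /orP[/bD|/b2D].
Qed.

(** Upper bound: an optimal representation of [u], cut at its length, leaves a carry [c], and
    replacing [y] by [y + c] costs at most [U]. Lower bound: an optimal representation of [z], cut
    there, has [y + c] as upper part; removing [c] from it costs [U], and so does completing the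
    lower part with [c] to a representation of [u]. *)
Lemma mw_shift_quasi_additive u y : {subset u <= AI} -> Zadjv tau y ->
  let z := value tau u + tau ^+ size u *: y in
  (mwD z <= mwD (value tau u) + mwD y + U)%N /\
  (mwD (value tau u) + mwD y <= mwD z + (U + U))%N.
Proof.
move=> uA yZ z; have uZ := Zadjv_value AI_Z uA.
have zZ : Zadjv tau z by apply: ZadjvD => //; exact: Zadjv_exp.
split.
  have [b1 [b2 [sb b1D b2D ub ->]]] := mw_split (size u) uZ.
  pose c := value tau b2; have cZ : Zadjv tau c := Zadjv_value DD_Z b2D.
  have Cc : C c by apply: (carry_closed C0 (esym sb) uA b1D cZ); rewrite add0r sb.
  have -> : z = value tau b1 + tau ^+ size b1 *: (y + c).
    by rewrite /z ub sb scalerDr addrA addrAC.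
  apply: leq_trans (mw_cat_le b1D (ZadjvD yZ cZ)) _.
  have [h _] := C_shift Cc yZ.
  by lia.
have [b1 [b2 [sb b1D b2D zb ->]]] := mw_split (size u) zZ.
pose c := value tau b2 - y.
have cZ : Zadjv tau c by apply: ZadjvB => //; exact: Zadjv_value DD_Z b2D.
have ub : value tau u = value tau b1 + tau ^+ size b1 *: c.
  by rewrite /c scalerBr addrA sb -zb /z addrK.
have Cc : C c by apply: (carry_closed C0 (esym sb) uA b1D cZ); rewrite add0r.
have [_ h] := C_shift Cc yZ.
have h1 := mw_cat_le b1D cZ; rewrite -ub in h1.
have h2 := mw_carry Cc.
have h3 := mw_le b2D; rewrite (_ : value tau b2 = y + c) in h3; last by rewrite /c addrC subrK.
by lia.
Qed.

Hypothesis AI0 : 0 \in AI.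
Hypothesis tau0 : tau != 0.
Hypothesis nonunit : forall t : algC, Zadj tau t -> tau * t != 1.
Hypothesis DD_nondiv : forall x y, x \in DD -> Zadjv tau y -> x = tau *: y -> x = 0.

(** If the sum were zero, its first digit would be divisible by tau, hence zero, and the rest would
    vanish too after division by tau; this descends to [y]. *)
Lemma nonzero_carry b y : {subset b <= DD} -> Zadjv tau y -> y != 0 ->
  value tau b + tau ^+ size b *: y != 0.
Proof.
move=> + yZ y0; elim: b => [|x b IH] bD; first by rewrite value_nil add0r expr0 scale1r.
have bD' : {subset b <= DD} by move=> w wb; apply: bD; rewrite inE wb orbT.
set v := value tau b + tau ^+ size b *: y in IH.
have vZ : Zadjv tau v.
  by apply: ZadjvD; [exact: Zadjv_value DD_Z bD' | exact: Zadjv_exp].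
rewrite /= value_cons exprS -scalerA -addrA -scalerDr -/v.
apply: contraNneq (IH bD') => e; move/eqP: (e); rewrite addr_eq0 => /eqP xv.
have x0 : x = 0.
  apply: (DD_nondiv (bD x (mem_head _ _)) (ZadjvN vZ)).
  by rewrite scalerN.
by move: e; rewrite x0 add0r => /eqP; rewrite scaler_eq0 (negbTE tau0).
Qed.

Lemma tau_exp_neq1 k : tau ^+ k.+1 != 1.
Proof. by rewrite exprS; apply: nonunit; exact: Zadj_exp. Qed.

(* The quotients of c by powers of tau are carries, hence two of them agree. *)
Lemma carry_not_divisible c y : C c -> Zadjv tau y -> c = tau ^+ size s *: y -> y = 0.
Proof.
move=> Cc yZ cy; apply/eqP/negPn/negP => y0.
pose f i := tau ^+ (size s - i) *: y.
have Cf i : (i <= size s)%N -> C (f i).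
  elim: i => [|i IH] si; first by rewrite /f subn0 -cy.
  apply: (C_carry (IH (ltnW si)) AI0 DD0); first exact: Zadjv_exp.
  by rewrite addr0 subr0 /f scalerA -exprS subnSK.
suff : (size [seq f i | i <- iota 0 (size s).+1] <= size s)%N.
  by rewrite size_map size_iota ltnn.
apply: uniq_leq_size; last first.
  by move=> _ /mapP[i + ->]; rewrite mem_iota add0n ltnS => /= si; apply/C_finite/Cf.
rewrite map_inj_in_uniq ?iota_uniq// => i j.
rewrite !mem_iota !add0n !ltnS => /= si sj.
wlog ij : i j si sj / (i <= j)%N.
  by move=> H; case: (leqP i j) => [/H|/ltnW/H]; [apply | move=> h /esym/h ->].
move=> /eqP; rewrite /f -subr_eq0 -scalerBl scaler_eq0 (negbTE y0) orbF.
have -> : (size s - i = (size s - j) + (j - i))%N by lia.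
rewrite exprD -[X in _ - X]mulr1 -mulrBr mulf_eq0 expf_eq0 (negbTE tau0) andbF /=.
case E : (j - i)%N => [|k]; first by move=> _; lia.
by rewrite subr_eq0 (negbTE (tau_exp_neq1 k)).
Qed.

(** Every window of [size s] digits contains a nonzero one: otherwise the incoming carry would be
    divisible by tau^(size s), so the outgoing carry would be zero by [carry_not_divisible], against
    [nonzero_carry]. *)
Lemma carry_run_weight k b c y : {subset b <= DD} -> C c -> Zadjv tau y -> y != 0 ->
  c = value tau b + tau ^+ size b *: y -> (size s * k <= size b)%N ->
  (k <= hamming_weight b)%N.
Proof.
move=> + + yZ y0; elim: k b c => // k IH b c bD Cc cb sk.
pose b1 := take (size s) b; pose b2 := drop (size s) b.
have b12 : b = b1 ++ b2 by rewrite cat_take_drop.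
have b1D : {subset b1 <= DD} by move=> x /mem_take/bD.
have b2D : {subset b2 <= DD} by move=> x /mem_drop/bD.
have sb1 : size b1 = size s by rewrite size_takel//; lia.
pose c1 := value tau b2 + tau ^+ size b2 *: y.
have c1Z : Zadjv tau c1.
  by apply: ZadjvD; [exact: Zadjv_value DD_Z b2D | exact: Zadjv_exp].
have cc1 : c = value tau b1 + tau ^+ size b1 *: c1.
  by rewrite cb b12 value_cat size_cat exprD /c1 scalerDr scalerA addrA.
have Cc1 : C c1.
  apply: (@carry_closed (nseq (size b1) 0) b1 c) => //; first by rewrite size_nseq.
    by move=> x; rewrite mem_nseq => /andP[_ /eqP->].
  by rewrite value_zeros addr0.
have h2 : (k <= hamming_weight b2)%N.
  by apply: (IH b2 c1) => //; rewrite size_drop; lia.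
have h1 : (0 < hamming_weight b1)%N.
  rewrite lt0n; apply/negP; rewrite /hamming_weight -leqn0 leqNgt -has_count => /hasPn h.
  have b1E : b1 = nseq (size s) 0.
    by rewrite -sb1; apply/all_pred1P/allP => x xb; have := h x xb; rewrite negbK.
  have c10 : c1 = 0.
    by apply: (carry_not_divisible Cc c1Z); rewrite cc1 sb1 b1E value_zeros add0r.
  by have := nonzero_carry b2D yZ y0; rewrite -/c1 c10 eqxx.
by rewrite b12 /hamming_weight count_cat -!/(hamming_weight _); lia.
Qed.

(** Upper bound: the run of zeros leaves enough room to write out the carry of [u] optimally. Lower
    bound: a nonzero carry crossing the run costs at least 2U there, which pays for stopping it at
    the end of [u] (at most U) and for correcting [y] (at most U). *)
Lemma mw_separator : exists M, forall u y, {subset u <= AI} -> Zadjv tau y ->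
  mwD (value tau u + tau ^+ (size u + M) *: y) = (mwD (value tau u) + mwD y)%N.
Proof.
have [Lm HLm] : exists Lm, forall c, c \in s -> C c -> exists b,
    [/\ representation tau DD c b, hamming_weight b = mwD c & (size b <= Lm)%N].
  apply: seq_nat_bound => [c m n mn H Cc|c _].
    by have [b [h1 h2 h3]] := H Cc; exists b; split => //; exact: leq_trans mn.
  have [Cc|nC] := pselect (C c); last by exists 0%N.
  have [b bc bw] := mw_attained (C_Z Cc).
  by exists (size b) => _; exists b; split.
(* [Lm] digits suffice to write any carry optimally; [2U] windows of length [size s] force weight
   [2U] on a surviving carry. *)
pose M := (size s * (U + U) + Lm)%N.
exists M => u y uA yZ; apply/eqP; rewrite eqn_leq.
have uZ := Zadjv_value AI_Z uA.
set z := value tau u + _.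
have zZ : Zadjv tau z by apply: ZadjvD => //; exact: Zadjv_exp.
apply/andP; split.
  have [b1 [b2 [sb b1D b2D ub mwu]]] := mw_split (size u) uZ.
  pose c := value tau b2; have cZ : Zadjv tau c := Zadjv_value DD_Z b2D.
  have Cc : C c by apply: (carry_closed C0 (esym sb) uA b1D cZ); rewrite add0r sb.
  have [b [[bD bc] bw bL]] := HLm c (C_finite Cc) Cc.
  pose b' := b1 ++ b ++ nseq (M - size b) 0.
  have b'D : {subset b' <= DD}.
    move=> x; rewrite !mem_cat => /or3P[/b1D//|/bD//|].
    by rewrite mem_nseq => /andP[_ /eqP->].
  have sb' : size b' = (size u + M)%N.
    by rewrite /b' !size_cat size_nseq sb subnKC// (leq_trans bL)// /M leq_addl.
  have -> : z = value tau b' + tau ^+ size b' *: y.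
    rewrite sb' /z; congr (_ + _).
    by rewrite /b' !value_cat value_zeros scaler0 addr0 bc sb ub.
  apply: leq_trans (mw_cat_le b'D yZ) _; rewrite leq_add2r.
  rewrite /b' /hamming_weight !count_cat count_nseq eqxx mul0n addn0.
  by rewrite -!/(hamming_weight _) mwu leq_add2l bw; exact: mw_le.
have [b12 [b3 [sb12 b12D b3D zb ->]]] := mw_split (size u + M)%N zZ.
pose b1 := take (size u) b12; pose b2 := drop (size u) b12.
have b12E : b12 = b1 ++ b2 by rewrite cat_take_drop.
have b1D : {subset b1 <= DD} by move=> x /mem_take/b12D.
have b2D : {subset b2 <= DD} by move=> x /mem_drop/b12D.
have sb1 : size b1 = size u by rewrite size_takel// sb12 leq_addr.
have sb2 : size b2 = M by rewrite size_drop sb12 addKn.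
pose c' := value tau b3 - y.
have b3E : value tau b3 = y + c' by rewrite /c' addrC subrK.
have c'Z : Zadjv tau c' by apply: ZadjvB => //; exact: Zadjv_value DD_Z b3D.
have ub : value tau u = value tau b12 + tau ^+ size b12 *: c'.
  by rewrite /c' scalerBr addrA sb12 -zb /z addrK.
clearbody c'.
have [c'0|c'0] := eqVneq c' 0.
  rewrite leq_add// -1?[y in mwD y](_ : value tau b3 = y) ?mw_le//.
    by rewrite ub c'0 scaler0 addr0 mw_le.
  by rewrite b3E c'0 addr0.
(* [c] is the carry leaving [u], and [c'] the one that enters [y] after the run of zeros. *)
pose c := value tau b2 + tau ^+ size b2 *: c'.
have cZ : Zadjv tau c.
  by apply: ZadjvD; [exact: Zadjv_value DD_Z b2D | exact: Zadjv_exp].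
have ub1 : value tau u = value tau b1 + tau ^+ size b1 *: c.
  by rewrite ub b12E value_cat size_cat exprD /c scalerDr scalerA addrA.
have Cc : C c by apply: (carry_closed C0 (esym sb1) uA b1D cZ); rewrite add0r.
have Cc' : C c'.
  apply: (@carry_closed (nseq (size b2) 0) b2 c) => //; first by rewrite size_nseq.
    by move=> x; rewrite mem_nseq => /andP[_ /eqP->].
  by rewrite value_zeros addr0.
have hb2 : (U + U <= hamming_weight b2)%N.
  by apply: (carry_run_weight b2D Cc c'Z c'0 erefl); rewrite sb2 leq_addr.
have [_ h1] := C_shift Cc' yZ.
have h2 := mw_carry Cc.
have h3 := mw_cat_le b1D cZ; rewrite -ub1 in h3.
have h4 := mw_le b3D; rewrite b3E in h4.
by rewrite b12E /hamming_weight count_cat -!/(hamming_weight _); lia.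
Qed.

End MinimalWeight.

(** If tau were a unit, every digit would be a multiple of tau, hence zero, and only the zero vector
    would be representable. *)
Lemma nondivisible_nonunit (tau : algC) d (DD : {fset 'rV[algC]_d}) : (0 < d)%N ->
  [set` DD] `<=` @Zadjv tau d ->
  (forall x y, x \in DD -> Zadjv tau y -> x = tau *: y -> x = 0) ->
  (forall z, Zadjv tau z -> exists b, representation tau DD z b) ->
  forall t, Zadj tau t -> tau * t != 1.
Proof.
case: d DD => // d DD _ DZ Dnd Drep t tZ; apply/negP => /eqP tt1.
have D0 x : x \in DD -> x = 0.
  move=> xD; apply: (Dnd x (t *: x) xD); last by rewrite scalerA tt1 scale1r.
  by move=> i; rewrite mxE; apply: ZadjM => //; exact: DZ.
have [|b [bD]] := Drep (const_mx 1); first by move=> i; rewrite mxE; exact: (Zadj_int tau 1).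
have -> : value tau b = 0.
  rewrite /value big1// => i _; rewrite (D0 b`_i) ?scaler0//.
  by apply: bD; exact: mem_nth.
by move=> /rowP/(_ 0)/eqP; rewrite !mxE eq_sym oner_eq0.
Qed.

(** The carries are the vectors whose entries have all conjugates bounded by some [m]. All
    conjugates of tau being larger than 1 in modulus, division by tau compensates for the digits
    added and subtracted. *)
Lemma carry_set_exists (tau : algC) d (DD AI : {fset 'rV[algC]_d}) :
  tau \in Aint -> (0 < d)%N -> [set` DD] `<=` @Zadjv tau d ->
  (forall x y, x \in DD -> Zadjv tau y -> x = tau *: y -> x = 0) ->
  (forall z, Zadjv tau z -> exists b, representation tau DD z b) ->
  [set` AI] `<=` @Zadjv tau d ->
  exists (C : set 'rV[algC]_d) (s : seq 'rV[algC]_d),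
    [/\ C 0, C `<=` @Zadjv tau d, forall c, C c -> c \in s &
    forall c a x c', C c -> a \in AI -> x \in DD -> Zadjv tau c' ->
      tau *: c' = c + a - x -> C c'].
Proof.
move=> tau_int d0 DZ Dnd Drep AZ.
have nonunit := nondivisible_nonunit d0 DZ Dnd Drep.
have [p [rs [pmon [urs taurs] prs wd inj]]] := conjugates_exist tau_int.
have [mD HmD] := digits_conj_bounded rs DZ.
have [mA HmA] := digits_conj_bounded rs AZ.
have s_gt1 sigma : sigma \in rs -> 1 < `|sigma|.
  move=> srs; rewrite lt_neqAle eq_sym (conj_norm_neq1 pmon prs inj nonunit srs)/=.
  exact: (conj_norm_ge1 wd DZ d0 Drep srs).
(* The condition says m + mA + mD <= m |sigma|, which makes the bound [m] stable under one carry
   step. *)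
have [||m Hm] := @seq_nat_bound _ rs
    (fun sigma m => 1 < `|sigma| -> (mA + mD)%:R <= m%:R * (`|sigma| - 1)).
- move=> sigma m n mn h s1; apply: le_trans (h s1) _.
  by rewrite ler_wpM2r ?ler_nat// subr_ge0 ltW.
- move=> sigma _; have [m Hm] := algC_nat_bound ((mA + mD)%:R / (`|sigma| - 1)).
  exists m => s1; have s0 : 0 < `|sigma| - 1 by rewrite subr_gt0.
  have q0 : 0 <= (mA + mD)%:R / (`|sigma| - 1) by rewrite divr_ge0// ltW.
  by rewrite -ler_pdivrMr//; move: Hm; rewrite (ger0_norm q0).
have [s Hs] := conj_bounded_finite pmon urs taurs prs m.
exists (fun c => forall i, conj_bounded tau rs m (c 0 i)).
exists [seq \row_i s`_(g i) | g : {ffun 'I_d -> 'I_(size s)}]; split.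
- move=> i; exists 0; first by rewrite rmorph0 horner0 mxE.
  by move=> sigma _; rewrite rmorph0 horner0 normr0.
- by move=> c Cc i; have [q <- _] := Cc i; exists q.
- move=> c Cc; have ltc (i : 'I_d) : (index (c 0%R i) s < size s)%N by rewrite index_mem; exact: Hs.
  apply/mapP; exists [ffun i => Ordinal (ltc i)]; first by rewrite mem_enum.
  by apply/rowP => i; rewrite mxE ffunE /= nth_index//; exact: Hs.
move=> c a x c' Cc aA xD c'Z e i.
have [q' q'c'] : exists q', ev q' tau = c' 0 i by have [q' _ ?] := c'Z i; exists q'.
have [qc qcE qcm] := Cc i.
have [qa qaE qam] := HmA a aA i.
have [qx qxE qxm] := HmD x xD i.
exists q' => // sigma srs.
have : ev ('X * q') sigma = ev (qc + qa - qx) sigma.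
  apply: (conj_wd_eq wd srs); rewrite !int_hornerE q'c' qcE qaE qxE.
  by move/rowP: e => /(_ i); rewrite !mxE.
rewrite !int_hornerE => /(congr1 Num.norm); rewrite normrM => e'.
have s0 : 0 < `|sigma| by apply: lt_trans (s_gt1 _ srs).
rewrite -(ler_pM2l s0) e'.
apply: (@le_trans _ _ (m%:R + (mA + mD)%:R)).
  rewrite natrD addrA; apply: le_trans (ler_normB _ _) _; apply: lerD; last exact: qxm.
  by apply: le_trans (ler_normD _ _) _; apply: lerD; [exact: qcm | exact: qam].
have := Hm sigma srs (s_gt1 _ srs).
by rewrite mulrBr mulr1 lerBrDl [leRHS]mulrC.
Qed.

(** * Means over random words *)

Section WordMean.
Variables (R : realType) (A : finType).
Implicit Types (n m k : nat) (f g : seq A -> R) (u v w : seq A).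

(** The expectation over a uniform random word, averaged letter by letter. The probabilistic
    argument is thus carried out with finite sums, and [expectation_word_mean] links it to the given
    probability spaces. *)
Fixpoint word_mean n f : R :=
  if n is m.+1 then #|A|%:R^-1 * \sum_a word_mean m (fun w => f (a :: w))
  else f [::].
Local Notation Ex := word_mean.

Lemma eq_word_mean n f g : (forall w, size w = n -> f w = g w) -> Ex n f = Ex n g.
Proof.
elim: n f g => [|n IHn] f g fg /=; first exact: fg.
by congr (_ * _); apply: eq_bigr => a _; apply: IHn => w sw; apply: fg; rewrite /= sw.
Qed.

Lemma ler_word_mean n f g : (forall w, size w = n -> f w <= g w) -> Ex n f <= Ex n g.
Proof.
elim: n f g => [|n IHn] f g fg /=; first exact: fg.
rewrite ler_wpM2l ?invr_ge0//; apply: ler_sum => a _.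
by apply: IHn => w sw; apply: fg; rewrite /= sw.
Qed.

Lemma word_meanD n f g : Ex n (fun w => f w + g w) = Ex n f + Ex n g.
Proof.
by elim: n f g => //= n IHn f g; rewrite -mulrDr -big_split; under eq_bigr do rewrite IHn.
Qed.

Lemma word_meanZ n c f : Ex n (fun w => c * f w) = c * Ex n f.
Proof.
elim: n f => //= n IHn f; rewrite mulrCA; congr (_ * _).
by rewrite mulr_sumr; under eq_bigr do rewrite IHn.
Qed.

Lemma word_meanN n f : Ex n (fun w => - f w) = - Ex n f.
Proof.
rewrite -mulN1r -word_meanZ; apply: eq_word_mean => w _; by rewrite mulN1r.
Qed.

Lemma word_meanB n f g : Ex n (fun w => f w - g w) = Ex n f - Ex n g.
Proof. by rewrite word_meanD word_meanN. Qed.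

Lemma word_mean_cat n m f : Ex (n + m) f = Ex n (fun u => Ex m (fun v => f (u ++ v))).
Proof. by elim: n f => //= n IHn f; under eq_bigr do rewrite IHn. Qed.

Lemma word_mean_sum (I : finType) n (F : I -> seq A -> R) :
  Ex n (fun w => \sum_i F i w) = \sum_i Ex n (F i).
Proof.
elim: n F => //= n IHn F; rewrite -mulr_sumr exchange_big/=; congr (_ * _).
by apply: eq_bigr => a _; rewrite IHn.
Qed.

Lemma word_mean_exchange n m (F : seq A -> seq A -> R) :
  Ex n (fun u => Ex m (fun v => F u v)) = Ex m (fun v => Ex n (fun u => F u v)).
Proof.
elim: n F => //= n IHn F; rewrite word_meanZ word_mean_sum.
by congr (_ * _); apply: eq_bigr => a _; rewrite IHn.
Qed.

Lemma word_mean_rcons n f :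
  Ex n.+1 f = Ex n (fun w => #|A|%:R^-1 * \sum_a f (rcons w a)).
Proof.
elim: n f => [|n IHn] f; first by [].
transitivity (#|A|%:R^-1 * \sum_a Ex n.+1 (fun w => f (a :: w))) => //.
by under eq_bigr do rewrite IHn.
Qed.

Lemma word_mean_rev n f : Ex n (fun w => f (rev w)) = Ex n f.
Proof.
elim: n f => //= n IHn f; rewrite -[RHS]/(Ex n.+1 f) word_mean_rcons.
rewrite word_meanZ word_mean_sum; congr (_ * _); apply: eq_bigr => a _.
by rewrite -IHn; apply: eq_word_mean => w _; rewrite rev_cons revK.
Qed.

Hypothesis A0 : (0 < #|A|)%N.

Lemma word_mean_cst n c : Ex n (fun=> c) = c.
Proof.
elim: n => //= n ->; rewrite sumr_const -[c in LHS]mul1r -mulrnAl mulrA mulVf ?mul1r//.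
by rewrite pnatr_eq0 -lt0n.
Qed.

Lemma ler_norm_word_mean n f : `|Ex n f| <= Ex n (fun w => `|f w|).
Proof.
rewrite ler_norml -word_meanN; apply/andP; split; apply: ler_word_mean => w _.
  by rewrite lerNl -normrN ler_norm.
exact: ler_norm.
Qed.

Lemma word_mean_bound n f c : (forall w, size w = n -> `|f w| <= c) -> `|Ex n f| <= c.
Proof.
move=> fc; apply: le_trans (ler_norm_word_mean n f) _.
by rewrite -[leRHS](word_mean_cst n); exact: ler_word_mean.
Qed.

Lemma word_mean_pattern w0 : 0 < Ex (size w0) (fun w => (w == w0)%:R).
Proof.
elim: w0 => [|a w0 IH] /=; first exact: ltr01.
apply: mulr_gt0; first by rewrite invr_gt0 ltr0n.
rewrite (bigD1 a)//= ltr_pwDl//.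
  by under eq_word_mean do rewrite eqseq_cons eqxx.
apply: sumr_ge0 => b _; rewrite -(word_mean_cst (size w0) 0).
by apply: ler_word_mean.
Qed.

End WordMean.

(** * ** Quasi-additivity and linear growth of the mean *)

Section QuasiAdditiveSequence.
Variables (R : realType) (a : nat -> R) (K : R).
Hypothesis aD : forall n m, `|a (n + m)%N - a n - a m| <= K.

Lemma quasi_additive_mul n k : (0 < k)%N -> `|a (k * n)%N - k%:R * a n| <= (k%:R - 1) * K.
Proof.
elim: k => // -[|k] IH _; first by rewrite mul1n mul1r !subrr mul0r normr0.
rewrite mulSn (_ : _ - _ =
  (a (n + k.+1 * n)%N - a n - a (k.+1 * n)%N) + (a (k.+1 * n)%N - k.+1%:R * a n)).
  apply: (le_trans (ler_normD _ _)); have := IH isT; have := aD n (k.+1 * n).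
  by rewrite (natrD _ 1 k.+1); lra.
by rewrite (natrD _ 1 k.+1); ring.
Qed.

(** Comparison through a(nm) shows that each (a n - K) / n lies below each (a m + K) / m. The slope
    is a number separating the two families. *)
Lemma quasi_additive_linear : exists E, forall n, `|a n - E * n%:R| <= K.
Proof.
have K0 : 0 <= K by apply: le_trans (aD 0 0).
pose S := [set ((a n.+1 - K) / n.+1%:R) | n in [set: nat]].
have cmp n m : (0 < n)%N -> (0 < m)%N -> (a n - K) / n%:R <= (a m + K) / m%:R.
  move=> n0 m0; rewrite ler_pdivrMr ?ltr0n// mulrAC ler_pdivlMr ?ltr0n//.
  have := quasi_additive_mul m n0; have := quasi_additive_mul n m0.
  rewrite mulnC !ler_distlC => /andP[_ +] /andP[+ _].
  have n1 : 1 <= n%:R :> R by rewrite ler1n.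
  have m1 : 1 <= m%:R :> R by rewrite ler1n.
  by nra.
have ubS m : ubound S ((a m.+1 + K) / m.+1%:R).
  by move=> _ [n _ <-]; exact: cmp.
exists (sup S) => -[|n]; first by rewrite mulr0 subr0; have := aD 0 0; rewrite addn0 subrr sub0r normrN.
have n0 : 0 < n.+1%:R :> R by rewrite ltr0n.
have h1 : (a n.+1 - K) / n.+1%:R <= sup S.
  apply: ub_le_sup; first by exists ((a 1%N + K) / 1%:R); exact: ubS 0%N.
  by exists n.
have h2 : sup S <= (a n.+1 + K) / n.+1%:R.
  by apply: ge_sup; [exists ((a 1%N - K) / 1%:R); exists 0%N | exact: ubS].
move: h1 h2; rewrite ler_pdivrMr// ler_pdivlMr// ler_distl => h1 h2.
by apply/andP; split; lra.
Qed.

End QuasiAdditiveSequence.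

Section QuasiAdditive.
Variables (R : realType) (A : finType) (W : seq A -> R) (K : R).
Implicit Types (n m k : nat) (u v w : seq A).
Hypothesis A0 : (0 < #|A|)%N.
Hypothesis W_nil : W [::] = 0.
Hypothesis WD : forall u v, `|W (u ++ v) - W u - W v| <= K.

Local Notation Ex := (@word_mean R A).
Local Notation a n := (Ex n W).
Local Notation X n w := (W w - a n).
Local Notation var n := (Ex n (fun w => X n w ^+ 2)).

Lemma quasi_additive_const_ge0 : 0 <= K.
Proof. exact: le_trans (normr_ge0 _) (WD [::] [::]). Qed.

Lemma quasi_additive_lipschitz : exists2 L, 0 <= L & forall w, `|W w| <= L * (size w)%:R.
Proof.
exists (\sum_b `|W [:: b]| + K).
  by rewrite addr_ge0 ?quasi_additive_const_ge0// sumr_ge0.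
elim=> [|b w IH]; first by rewrite W_nil normr0 mulr0.
have WbK : `|W [:: b]| <= \sum_b `|W [:: b]| by rewrite (bigD1 b)//= lerDl sumr_ge0.
have -> : W (b :: w) = (W (b :: w) - W [:: b] - W w) + W [:: b] + W w by ring.
apply: le_trans (ler_normD _ _) _; rewrite /= -addn1 natrD mulrDr mulr1 addrC lerD//.
by apply: le_trans (ler_normD _ _) _; rewrite addrC lerD//; exact: (WD [:: b] w).
Qed.

Lemma mean_quasi_additive n m : `|a (n + m)%N - a n - a m| <= K.
Proof.
rewrite word_mean_cat -(word_mean_cst A0 n (a m)) -!word_meanB.
apply: word_mean_bound => // u _.
rewrite -(word_mean_cst A0 m (W u)) -!word_meanB.
by apply: word_mean_bound => // v _.
Qed.

Lemma mean_linear : exists E, forall n, `|a n - E * n%:R| <= K.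
Proof. exact: (quasi_additive_linear (a := fun n => a n) mean_quasi_additive). Qed.

Lemma word_mean_centered n : Ex n (fun w => X n w) = 0.
Proof. by rewrite word_meanB word_mean_cst// subrr. Qed.

Lemma centered_bound L : (forall w, `|W w| <= L * (size w)%:R) ->
  forall n w, size w = n -> `|X n w| <= 2 * L * n%:R.
Proof.
move=> WL n w sw; apply: le_trans (ler_normB _ _) _.
have h1 : `|W w| <= L * n%:R by rewrite -sw.
have h2 : `|a n| <= L * n%:R by apply: word_mean_bound => // u <-.
by lra.
Qed.

Lemma centered_quasi_additive n m u v : `|X (n + m)%N (u ++ v) - X n u - X m v| <= 2 * K.
Proof.
have -> : X (n + m)%N (u ++ v) - X n u - X m v =
  (W (u ++ v) - W u - W v) - (a (n + m)%N - a n - a m) by ring.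
apply: le_trans (ler_normB _ _) _; have := WD u v; have := mean_quasi_additive n m; lra.
Qed.

(* The proof expands over the last M letters: if they form the separator, d is
   constant, and the remaining mass 1 - p makes the bound a fixed point. *)
Lemma separator_decoupling (M : nat) (z : A) (Kd : R) : exists C, forall n (d : seq A -> R),
  (forall w, `|d w| <= Kd) -> (forall u v, d (u ++ nseq M z ++ v) = d v) ->
  `|Ex n (fun w => X n w * d w)| <= C.
Proof.
have [L L0 WL] := quasi_additive_lipschitz.
have K0 := quasi_additive_const_ge0.
have := word_mean_pattern R A0 (nseq M z); rewrite size_nseq.
set p := Ex M _ => p0.
(* The first factor bounds the change of the centred weight when the last M letters are dropped:
   [2 * K] for the cut and [2 * L * M] for these letters themselves. *)
pose B := (2 * K + 2 * L * M%:R) * `|Kd|.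
have B0 : 0 <= B by rewrite mulr_ge0// addr_ge0// ?mulr_ge0.
have [M0|M_gt0] := posnP M.
  exists 0 => n d _ dM.
  have d0 w : d w = d [::] by have := dM w [::]; rewrite M0 !cats0.
  under eq_word_mean do rewrite d0 mulrC.
  by rewrite word_meanZ word_mean_centered mulr0 normr0.
exists (B / p); elim/ltn_ind => n IH d dK dM.
have dKabs w : `|d w| <= `|Kd| by apply: le_trans (dK w) _; exact: ler_norm.
have p1 : p <= 1.
  rewrite -(word_mean_cst A0 M 1); apply: ler_word_mean => w _.
  by case: (_ == _).
have [nM|Mn] := ltnP n M.
  apply: (@le_trans _ _ B); last by rewrite ler_pdivlMr// ler_piMr.
  apply: word_mean_bound => // w sw; rewrite normrM ler_pM//.
  apply: le_trans (centered_bound WL sw) _.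
  have : n%:R <= M%:R :> R by rewrite ler_nat ltnW.
  by nra.
rewrite -(subnK Mn) word_mean_cat word_mean_exchange.
set n' := (n - M)%N.
have n'n : (n' < n)%N by rewrite /n'; lia.
apply: (@le_trans _ _ (Ex M (fun b => B + (1 - (b == nseq M z)%:R) * (B / p)))).
  apply: le_trans (ler_norm_word_mean _ _) _ => //.
  apply: ler_word_mean => b sb.
  have Xdiff u : size u = n' -> `|X (n' + M)%N (u ++ b) - X n' u| <= 2 * K + 2 * L * M%:R.
    move=> su; have := centered_quasi_additive n' M u b; have := centered_bound WL sb.
    rewrite -addrA -opprD.
    move=> h1 h2; rewrite (_ : X (n' + M)%N (u ++ b) - X n' u = (X (n' + M)%N (u ++ b) - (X n' u + X M b)) + X M b); last by ring.
    by apply: le_trans (ler_normD _ _) _; lra.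
  have -> : Ex n' (fun u => X (n' + M)%N (u ++ b) * d (u ++ b)) =
     Ex n' (fun u => (X (n' + M)%N (u ++ b) - X n' u) * d (u ++ b)) +
     Ex n' (fun u => X n' u * d (u ++ b)).
    by rewrite -word_meanD; apply: eq_word_mean => u _; ring.
  apply: le_trans (ler_normD _ _) _; apply: lerD.
    by apply: word_mean_bound => // u su; rewrite normrM ler_pM// Xdiff.
  (* After the separator [d] no longer depends on [u], so the term vanishes by centring; for any
     other ending the induction hypothesis applies to [d (_ ++ b)]. *)
  have [->|bz] := eqVneq b (nseq M z).
    have dz u : d (u ++ nseq M z) = d [::] by have := dM u [::]; rewrite !cats0.
    under eq_word_mean do rewrite dz mulrC.
    by rewrite word_meanZ word_mean_centered mulr0 normr0 subrr mul0r.
  rewrite subr0 mul1r; apply: (IH n' n'n (fun u => d (u ++ b))) => // u v.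
  by rewrite -!catA dM.
rewrite word_meanD word_mean_cst//; under eq_word_mean do rewrite mulrC.
rewrite word_meanZ word_meanB word_mean_cst// -/p.
rewrite le_eqVlt; apply/orP; left; apply/eqP; field; lra.
Qed.

End QuasiAdditive.

Lemma linear_growth_le (R : realType) (x y C : R) :
  (forall k : nat, k%:R * x <= k%:R * y + C) -> x <= y.
Proof.
move=> H; rewrite leNgt; apply/negP => yx.
have xy0 : 0 < x - y by rewrite subr_gt0.
have /(_ (Num.truncn (C / (x - y))).+1) := H.
have := truncnS_gt (C / (x - y)); rewrite ltr_pdivrMr// => h1 h2.
by nra.
Qed.

Lemma nat_halves n : exists h h', [/\ n.+2 = (h + h')%N, (0 < h < n.+2)%N,
  (0 < h' < n.+2)%N, (h <= h')%N & (h' <= h.+1)%N].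
Proof. by exists n.+2./2, (uphalf n.+2); split; lia. Qed.

(** * ** Variance and fourth moment *)

Section Variance.
Variables (R : realType) (A : finType) (W : seq A -> R) (K : R) (M : nat) (z : A).
Implicit Types (n m k : nat) (u v w : seq A).
Hypothesis A0 : (0 < #|A|)%N.
Hypothesis W_nil : W [::] = 0.
Hypothesis WD : forall u v, `|W (u ++ v) - W u - W v| <= K.
Hypothesis WM : forall u v, W (u ++ nseq M z ++ v) = W u + W v.

Local Notation Ex := (@word_mean R A).
Local Notation a n := (Ex n W).
Local Notation X n w := (W w - a n).
Local Notation var n := (Ex n (fun w => X n w ^+ 2)).

Let D n m u v := X (n + m)%N (u ++ v) - X n u - X m v.

(** In the square of X_n + X_m + D the product X_n X_m has mean zero. Averaged over [v], the error D
    depends on [u] only through the letters after a separator, so [separator_decoupling] bounds its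
    product with X_n; for X_m the same is done with reversed words. *)
Lemma var_quasi_additive : exists K2, forall n m, `|var (n + m)%N - var n - var m| <= K2.
Proof.
have [C1 HC1] := separator_decoupling A0 W_nil WD M z (2 * K).
pose W' w := W (rev w).
have W'D u v : `|W' (u ++ v) - W' u - W' v| <= K.
  by rewrite /W' rev_cat addrAC; exact: WD.
have W'M u v : W' (u ++ nseq M z ++ v) = W' u + W' v.
  by rewrite /W' !rev_cat rev_nseq -catA WM addrC.
have [C2 HC2] := separator_decoupling A0 (W_nil : W' [::] = 0) W'D M z (2 * K).
exists (2 * C1 + 2 * C2 + (2 * K) ^+ 2) => n m.
have DK u v : `|D n m u v| <= 2 * K by exact: centered_quasi_additive.
have := HC1 n (fun u => Ex m (D n m u)) _ _.
have := HC2 m (fun v => Ex n (fun u => D n m u (rev v))) _ _.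
rewrite /W' (word_mean_rev m W) (word_mean_rev m (fun v => X m v * Ex n (fun u => D n m u v))).
move=> h2 h1.
have {}h2 : `|Ex m (fun v => X m v * Ex n (fun u => D n m u v))| <= C2.
  apply: h2 => [w|u v]; first by apply: word_mean_bound.
  apply: eq_word_mean => x _; rewrite /D !rev_cat rev_nseq !catA -!catA WM catA.
  by rewrite WM; ring.
have {}h1 : `|Ex n (fun u => X n u * Ex m (D n m u))| <= C1.
  apply: h1 => [w|u v]; first by apply: word_mean_bound.
  by apply: eq_word_mean => x _; rewrite /D -!catA !WM; ring.
have hD : `|Ex n (fun u => Ex m (fun v => D n m u v ^+ 2))| <= (2 * K) ^+ 2.
  apply: word_mean_bound => // u _; apply: word_mean_bound => // v _.
  by rewrite normrX ler_sqr ?nnegrE// ?(le_trans _ (DK u v)).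
have : forall u v, X (n + m)%N (u ++ v) = X n u + X m v + D n m u v.
  by move=> u v; rewrite /D; ring.
move: (D n m) h1 h2 hD => d h1 h2 hD Xd {DK}.
have -> : var (n + m)%N - var n - var m =
    2 * Ex n (fun u => X n u * Ex m (d u)) +
    2 * Ex m (fun v => X m v * Ex n (fun u => d u v)) +
    Ex n (fun u => Ex m (fun v => d u v ^+ 2)).
  rewrite word_mean_cat.
  have -> : Ex m (fun v => X m v * Ex n (fun u => d u v)) =
      Ex n (fun u => Ex m (fun v => X m v * d u v)).
    by rewrite word_mean_exchange; apply: eq_word_mean => v _; rewrite word_meanZ.
  have -> : Ex n (fun u => Ex m (fun v => X (n + m)%N (u ++ v) ^+ 2)) =
     Ex n (fun u => X n u ^+ 2 + var m + 2 * (X n u * Ex m (d u)) +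
       2 * Ex m (fun v => X m v * d u v) + Ex m (fun v => d u v ^+ 2)).
    apply: eq_word_mean => u _.
    transitivity (Ex m (fun v => X n u ^+ 2 + X m v ^+ 2 + 2 * X n u * d u v +
       2 * (X m v * d u v) + d u v ^+ 2 + 2 * X n u * X m v)).
      by apply: eq_word_mean => v _; rewrite Xd; ring.
    by rewrite !word_meanD !word_meanZ word_mean_cst// word_mean_centered//; ring.
  by rewrite !word_meanD !word_meanZ word_mean_cst//; ring.
apply: le_trans (ler_normD _ _) _; apply: lerD => //.
apply: le_trans (ler_normD _ _) _; rewrite !normrM (ger0_norm (_ : 0 <= 2))//.
by apply: lerD; rewrite ler_wpM2l.
Qed.

Lemma var_linear : exists V K2, forall n, `|var n - V * n%:R| <= K2.
Proof.
have [K2 HK2] := var_quasi_additive.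
have [V HV] := @quasi_additive_linear R (fun n => var n) K2 HK2.
by exists V, K2.
Qed.

(** The factor 3/2 is below 2 because the bound serves a halving induction: two halves contribute
    about 2 C (n/2)^2, and 3/2 of this is 3/4 C n^2, which leaves room for error terms. *)
Lemma ler_pow4D : exists2 B : R, 0 <= B &
  forall s d, (s + d) ^+ 4 <= 3 / 2 * s ^+ 4 + B * d ^+ 4.
Proof.
exists 512; first by rewrite ler0n.
move=> s d.
(* Here (8/7)^2 < 3/2, so the cross term can be absorbed when this is squared. *)
have h : (s + d) ^+ 2 <= 8 / 7 * s ^+ 2 + 8 * d ^+ 2.
  rewrite -subr_ge0 (_ : _ - _ = (s - 7 * d) ^+ 2 / 7); last by field.
  by rewrite divr_ge0 ?sqr_ge0.
have -> : (s + d) ^+ 4 = ((s + d) ^+ 2) ^+ 2 by rewrite -exprM.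
apply: (@le_trans _ _ ((8 / 7 * s ^+ 2 + 8 * d ^+ 2) ^+ 2)).
  by rewrite ler_sqr// nnegrE ?sqr_ge0// addr_ge0// mulr_ge0// ?sqr_ge0//; lra.
have -> : s ^+ 4 = (s ^+ 2) ^+ 2 by rewrite -exprM.
have -> : d ^+ 4 = (d ^+ 2) ^+ 2 by rewrite -exprM.
move: (s ^+ 2) (d ^+ 2) => x y; rewrite -subr_ge0.
rewrite (_ : _ - _ = 19 / 98 * (x - 896 / 19 * y) ^+ 2 + 320 / 19 * y ^+ 2); last by field.
have c1 : 0 <= 19 / 98 :> R by lra.
have c2 : 0 <= 320 / 19 :> R by lra.
exact: addr_ge0 (mulr_ge0 c1 (sqr_ge0 _)) (mulr_ge0 c2 (sqr_ge0 _)).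
Qed.

(** Induction by halving: for two independent centred halves the fourth moment of the sum is the sum
    of the fourth moments plus 6 times the product of the variances, which is quadratic in the
    length; [ler_pow4D] absorbs the bounded error. *)
Lemma fourth_moment_bound : exists2 C, 0 <= C & forall n, Ex n (fun w => X n w ^+ 4) <= C * n%:R ^+ 2.
Proof.
have [B B0 pow4D] := ler_pow4D.
have [V [K2 HV]] := var_linear.
have [L L0 WL] := quasi_additive_lipschitz W_nil WD.
have K0 := quasi_additive_const_ge0 WD.
have K20 : 0 <= K2 by apply: le_trans (HV 0%N).
have var_ge0 n : 0 <= var n.
  by rewrite -(word_mean_cst A0 n 0); apply: ler_word_mean => w _; exact: sqr_ge0.
pose V1 := `|V| + K2.
have varV n : (0 < n)%N -> var n <= V1 * n%:R.
  move=> n0; have := HV n; rewrite ler_distl => /andP[_ h]; apply: le_trans h _.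
  have n1 : 1 <= n%:R :> R by rewrite ler1n.
  by rewrite /V1; have := ler_norm V; nra.
have V10 : 0 <= V1 by rewrite addr_ge0.
(* (2L)^4 covers length 1. The rest is twice 9 V1^2 + B (2K)^4, where 9 = 3/2 * 6 comes from the
   product of the variances. *)
pose C := 18 * V1 ^+ 2 + 2 * B * (2 * K) ^+ 4 + (2 * L) ^+ 4.
have C1 : 0 <= B * (2 * K) ^+ 4 by rewrite mulr_ge0// exprn_ge0// mulr_ge0.
have C2 : 0 <= (2 * L) ^+ 4 by rewrite exprn_ge0// mulr_ge0.
have C3 := sqr_ge0 V1.
have C0 : 0 <= C by rewrite /C; lra.
exists C => //; elim/ltn_ind => -[_|[_|n IH]].
- by rewrite /= subrr !expr0n /= mulr0.
- rewrite expr1n mulr1; apply: le_trans (_ : (2 * L) ^+ 4 <= _); last by rewrite /C; lra.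
  rewrite -[leRHS](word_mean_cst A0 1); apply: ler_word_mean => w sw.
  have := centered_bound A0 WL sw; rewrite mulr1 => h.
  rewrite -(@ger0_norm _ (X 1 w ^+ 4)) ?exprn_even_ge0// normrX.
  by rewrite lerXn2r// nnegrE mulr_ge0.
have [h [h' [hh' /andP[h0 hN] /andP[h'0 h'N] hle h'le]]] := nat_halves n.
move: hle h'le; rewrite -!(ler_nat R) -natr1 => hle h'le.
have := IH _ hN; have := IH _ h'N; have := varV _ h0; have := varV _ h'0.
have := var_ge0 h; have := var_ge0 h'.
have h1 : 1 <= h%:R :> R by rewrite ler1n.
have h'1 : 1 <= h'%:R :> R by rewrite ler1n.
rewrite hh' => {IH hN h'N}  vh'0 vh0 vh' vh mh' mh.
pose T u v := (X h u + X h' v) ^+ 4.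
have sumE : Ex h (fun u => Ex h' (T u)) =
    Ex h (fun w => X h w ^+ 4) + Ex h' (fun w => X h' w ^+ 4) + 6 * var h * var h'.
  transitivity (Ex h (fun u => X h u ^+ 4 + 6 * var h' * X h u ^+ 2 +
      4 * Ex h' (fun v => X h' v ^+ 3) * X h u + Ex h' (fun w => X h' w ^+ 4))).
    apply: eq_word_mean => u _.
    transitivity (Ex h' (fun v => X h u ^+ 4 + 4 * X h u ^+ 3 * X h' v +
       6 * X h u ^+ 2 * X h' v ^+ 2 + 4 * X h u * X h' v ^+ 3 + X h' v ^+ 4)).
      by apply: eq_word_mean => v _; rewrite /T; ring.
    by rewrite !word_meanD !word_meanZ word_mean_cst// word_mean_centered//; ring.
  by rewrite !word_meanD !word_meanZ word_mean_cst// word_mean_centered//; ring.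
rewrite word_mean_cat.
apply: (@le_trans _ _ (Ex h (fun u => Ex h' (fun v =>
   3 / 2 * T u v + B * (2 * K) ^+ 4)))).
  apply: ler_word_mean => u _; apply: ler_word_mean => v _.
  have -> : X (h + h')%N (u ++ v) = (X h u + X h' v) + D h h' u v by rewrite /D; ring.
  apply: le_trans (pow4D _ _) _; rewrite lerD2l ler_wpM2l//.
  rewrite -(@ger0_norm _ (D h h' u v ^+ 4)) ?exprn_even_ge0// normrX.
  by rewrite lerXn2r// ?nnegrE ?mulr_ge0//; exact: centered_quasi_additive.
have -> : Ex h (fun u => Ex h' (fun v => 3 / 2 * T u v + B * (2 * K) ^+ 4)) =
    3 / 2 * Ex h (fun u => Ex h' (T u)) + B * (2 * K) ^+ 4.
  move: T {sumE} => T.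
  under eq_word_mean do rewrite word_meanD !word_meanZ word_mean_cst//.
  by rewrite word_meanD !word_meanZ word_mean_cst.
rewrite sumE natrD.
have vv : var h * var h' <= V1 ^+ 2 * (h%:R * h'%:R).
  rewrite (_ : V1 ^+ 2 * _ = (V1 * h%:R) * (V1 * h'%:R)); last by ring.
  by rewrite ler_pM.
move: (var h) (var h') (Ex h _) (Ex h' _) vh vh0 vh' vh'0 mh mh' vv => x x' y y'.
move: (h%:R) (h'%:R) h1 h'1 hle h'le => s t s1 t1 st ts _ _ _ _ mh mh' vv.
have st1 : 1 <= s * t by nra.
apply: (@le_trans _ _ (3 / 2 * C * (s ^+ 2 + t ^+ 2) + (9 * V1 ^+ 2 + B * (2 * K) ^+ 4) * (s * t))).
  have : B * (2 * K) ^+ 4 <= B * (2 * K) ^+ 4 * (s * t) by rewrite ler_peMr// mulr_ge0.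
  by lra.
have : 9 * V1 ^+ 2 + B * (2 * K) ^+ 4 <= C / 2 by rewrite /C; lra.
move: (9 * V1 ^+ 2 + _) => b bC.
(* The halves differ by at most 1 and s t >= 1, so they are balanced enough to spare s t / 2, which
   pays for [b * (s * t)]. *)
have stt : s * t / 2 <= 2 * (s * t) - (s ^+ 2 + t ^+ 2) / 2.
  by have : (t - s) ^+ 2 <= 1; nra.
have : b * (s * t) <= C / 2 * (s * t) by rewrite ler_wpM2r//; lra.
have : C * (s * t / 2) <= C * (2 * (s * t) - (s ^+ 2 + t ^+ 2) / 2) by rewrite ler_wpM2l.
by lra.
Qed.

End Variance.

(** * ** Positivity of the growth rate of the variance *)

Section BlockCount.
Variables (R : realType) (A : finType) (pat : seq A).
Hypothesis A0 : (0 < #|A|)%N.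
Implicit Types (k : nat) (u v w : seq A).

(** Only disjoint windows aligned at multiples of [size pat] are inspected, so that the count is a
    sum of independent indicators. *)
Fixpoint block_count k w : nat :=
  if k is k'.+1 then
    ((take (size pat) w == pat) + block_count k' (drop (size pat) w))%N
  else 0%N.

Local Notation Ex := (@word_mean R A).
Local Notation b := (size pat).
Local Notation p := (Ex b (fun w => (w == pat)%:R)).

Lemma block_count_cat k u v : size u = b -> block_count k.+1 (u ++ v) = ((u == pat) + block_count k v)%N.
Proof. by move=> su /=; rewrite -su take_size_cat// drop_size_cat. Qed.

Lemma mean_block_count k : Ex (k * b) (fun w => (block_count k w)%:R) = k%:R * p.
Proof.
elim: k => [|k IH]; first by rewrite mul0n /= mul0r.
rewrite mulSn word_mean_cat.
transitivity (Ex b (fun u => (u == pat)%:R + k%:R * p)).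
  apply: eq_word_mean => u su; rewrite -IH -(word_mean_cst A0 (k * b) (u == pat)%:R) -word_meanD.
  by apply: eq_word_mean => v _; rewrite block_count_cat// natrD.
by rewrite word_meanD word_mean_cst// -natr1; ring.
Qed.

(** The count is binomial with variance k p (1 - p), weakened here to k p. *)
Lemma var_block_count k : Ex (k * b) (fun w => ((block_count k w)%:R - k%:R * p) ^+ 2) <= k%:R * p.
Proof.
elim: k => [|k IH]; first by rewrite mul0n /= mul0r subrr expr0n.
rewrite mulSn word_mean_cat.
set S := Ex (k * b) _ in IH.
have p0 : 0 <= p by rewrite -(word_mean_cst A0 b 0); exact: ler_word_mean.
apply: (@le_trans _ _ (p * (1 - p) + S)); last first.
  by rewrite -natr1; nra.
rewrite le_eqVlt; apply/orP; left; apply/eqP.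
transitivity (Ex b (fun u => ((u == pat)%:R - p) ^+ 2 + S)).
  apply: eq_word_mean => u su.
  transitivity (Ex (k * b) (fun v => ((u == pat)%:R - p) ^+ 2 +
     2 * ((u == pat)%:R - p) * ((block_count k v)%:R - k%:R * p) +
     ((block_count k v)%:R - k%:R * p) ^+ 2)).
    by apply: eq_word_mean => v _; rewrite block_count_cat// natrD -natr1; ring.
  rewrite word_meanD word_meanD !word_meanZ word_mean_cst// word_meanB mean_block_count.
  by rewrite word_mean_cst// subrr mulr0 addr0.
rewrite word_meanD word_mean_cst//; congr (_ + _).
transitivity (Ex b (fun u => (1 - 2 * p) * (u == pat)%:R + p ^+ 2)).
  by apply: eq_word_mean => u _; case: (u == pat); rewrite /=; ring.
by rewrite word_meanD word_meanZ word_mean_cst//; ring.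
Qed.

End BlockCount.

Section Nondegeneracy.
Variables (R : realType) (A : finType) (W : seq A -> R) (K : R) (M : nat) (z c : A).
Implicit Types (n m k : nat) (u v w : seq A).
Hypothesis A0 : (0 < #|A|)%N.
Hypothesis W_ge0 : forall w, 0 <= W w.
Hypothesis WD : forall u v, `|W (u ++ v) - W u - W v| <= K.
Hypothesis WM : forall u v, W (u ++ nseq M z ++ v) = W u + W v.
Hypothesis W_zero : forall m, W (nseq m z) = 0.
Hypothesis W_digit : 1 <= W [:: c].

Local Notation Ex := (@word_mean R A).
Local Notation a n := (Ex n W).
Local Notation X n w := (W w - a n).
Local Notation var n := (Ex n (fun w => X n w ^+ 2)).

Let pattern := nseq M z ++ [:: c] ++ nseq M z.

(** A block equal to [pattern] isolates the letter [c] between separators and so contributes exactly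
    W [:: c] >= 1. Blocks that do not match are absorbed into the prefix [u]. *)
Lemma block_count_le k u v : (block_count pattern k v)%:R <= W (u ++ v).
Proof.
elim: k u v => [|k IH] u v; first exact: W_ge0.
have -> : u ++ v = u ++ take (size pattern) v ++ drop (size pattern) v.
  by rewrite cat_take_drop.
rewrite /=.
have [e|_] := eqVneq (take (size pattern) v) pattern; last by rewrite catA; exact: IH.
have := IH [::] (drop (size pattern) v); rewrite e natrD.
have -> x : W (u ++ pattern ++ x) = W u + (W [:: c] + W x).
  by rewrite /pattern -!catA !WM.
rewrite /=; have := W_ge0 u; have := W_digit; lra.
Qed.

Lemma mean_slope_gt0 E K' : (forall n, `|a n - E * n%:R| <= K') -> 0 < E.
Proof.
move=> HE.
have p0 := word_mean_pattern R A0 pattern; set p := Ex _ _ in p0.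
have : p <= E * (size pattern)%:R.
  apply: (@linear_growth_le _ _ _ K') => k.
  rewrite -mean_block_count//; have := HE (k * size pattern)%N; rewrite ler_distl natrM => /andP[_ h].
  apply: le_trans (_ : a (k * size pattern)%N <= _); last by lra.
  by apply: ler_word_mean => w _; exact: (block_count_le k [::]).
have : 0 < (size pattern)%:R :> R by rewrite ltr0n /pattern size_cat/= addnS.
by move=> s0 h; rewrite -(pmulr_lgt0 _ s0); exact: lt_le_trans h.
Qed.

(* Var W >= -2 t Cov(W, N) - t^2 Var N for the number N of blocks z^m and a
   suitable t; a block z^m lowers the mean of W by about E m. *)
Lemma var_slope_gt0 V K2 : (forall n, `|var n - V * n%:R| <= K2) -> 0 < V.
Proof.
move=> HV.
have K0 := quasi_additive_const_ge0 WD.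
have [E HE] := mean_linear A0 WD.
have E0 := mean_slope_gt0 HE.
(* This makes E m > 5K + 1, and the mean of length m differs from E m by at most K. *)
pose m := (Num.truncn ((5 * K + 1) / E)).+1.
have am : 1 <= a m - 4 * K.
  have := HE m; rewrite ler_distl => /andP[h _].
  have := truncnS_gt ((5 * K + 1) / E); rewrite ltr_pdivrMr// -/m => h2.
  by lra.
pose pat := nseq m z; have spat : size pat = m by rewrite size_nseq.
have := word_mean_pattern R A0 pat; rewrite spat; set p := Ex m _ => p0.
(* Covariance of the weight with the number of zero blocks. The prefix [u] makes induction on blocks
   possible: a first block of zeros has conditional mean at least a m - 4K >= 1 below the average
   one, so each block contributes at most -p. *)
have covP k u : Ex (k * m) (fun v => W (u ++ v) * ((block_count pat k v)%:R - k%:R * p)) <= - (k%:R * p).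
  elim: k u => [|k IH] u; first by rewrite mul0n /= !mul0r subrr mulr0 oppr0.
  rewrite mulSn word_mean_cat.
  pose G b := Ex (k * m) (fun v => W (u ++ b ++ v)).
  have GB b : `|G b - (W u + W b + a (k * m)%N)| <= 2 * K.
    have -> : G b - (W u + W b + a (k * m)%N) =
       Ex (k * m) (fun v => W (u ++ b ++ v) - (W u + W b + W v)).
      by rewrite word_meanB word_meanD word_mean_cst.
    apply: word_mean_bound => // v _.
    rewrite (_ : _ - _ = (W (u ++ b ++ v) - W u - W (b ++ v)) + (W (b ++ v) - W b - W v)); last by ring.
    by apply: le_trans (ler_normD _ _) _; have := WD u (b ++ v); have := WD b v; lra.
  apply: (@le_trans _ _ (Ex m (fun b => ((b == pat)%:R - p) * G b - k%:R * p))).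
    apply: ler_word_mean => b sb.
    have := IH (u ++ b); set S := Ex _ _ => Sle.
    suff -> : Ex (k * m) (fun v => W (u ++ b ++ v) * ((block_count pat k.+1 (b ++ v))%:R - k.+1%:R * p)) = ((b == pat)%:R - p) * G b + S by lra.
    rewrite /G /S -(word_meanZ (k * m) ((b == pat)%:R - p)) -word_meanD; apply: eq_word_mean => v _.
    by rewrite block_count_cat ?spat// natrD -natr1 catA; ring.
  rewrite word_meanB word_mean_cst//.
  suff : Ex m (fun b => ((b == pat)%:R - p) * G b) <= - p by rewrite -natr1; lra.
  apply: (@le_trans _ _ (p * G pat - p * Ex m G)).
    rewrite le_eqVlt; apply/orP; left; apply/eqP.
    rewrite -word_meanZ mulrC -word_meanZ -word_meanB.
    apply: eq_word_mean => b _; have [->|_] := eqVneq b pat; last by rewrite mulr0 /=; ring.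
    by rewrite mulr1 /=; ring.
  have Gpat : G pat <= W u + a (k * m)%N + 2 * K.
    by have := GB pat; rewrite W_zero ler_distl => /andP[_]; lra.
  have GE : W u + a m + a (k * m)%N - 2 * K <= Ex m G.
    apply: (@le_trans _ _ (Ex m (fun b => W u + W b + a (k * m)%N - 2 * K))).
      by rewrite !word_meanD word_meanN !word_mean_cst.
    by apply: ler_word_mean => b _; have := GB b; rewrite ler_distl => /andP[].
  by nra.
have : p <= V * m%:R.
  apply: (@linear_growth_le _ _ _ K2) => k.
  have := HV (k * m)%N; rewrite ler_distl natrM => /andP[_ h].
  apply: le_trans (_ : var (k * m)%N <= _); last by lra.
  have := covP k [::]; have := var_block_count R pat A0 k; rewrite spat -/p.
  have := mean_block_count R pat A0 k; rewrite spat -/p.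
  pose N w := (block_count pat k w)%:R - k%:R * p : R.
  move=> NE; rewrite -/(N _) => Nvar Ncov.
  (* Here t = 1 is enough: the variance is at least 2 k p - k p = k p. *)
  have : 0 <= Ex (k * m) (fun w => (X (k * m)%N w + N w) ^+ 2).
    rewrite -[leLHS](word_mean_cst A0 (k * m)); apply: ler_word_mean => w _; exact: sqr_ge0.
  have -> : Ex (k * m) (fun w => (X (k * m)%N w + N w) ^+ 2) =
     var (k * m)%N + 2 * Ex (k * m) (fun v => W v * N v) + Ex (k * m) (fun w => N w ^+ 2).
    transitivity (Ex (k * m) (fun w => X (k * m)%N w ^+ 2 + 2 * (W w * N w) - 2 * a (k * m)%N * N w + N w ^+ 2)).
      by apply: eq_word_mean => w _; ring.
    have -> : Ex (k * m) (fun w => X (k * m)%N w ^+ 2 + 2 * (W w * N w) - 2 * a (k * m)%N * N w + N w ^+ 2) = Ex (k * m) (fun w => X (k * m)%N w ^+ 2) + 2 * Ex (k * m) (fun w => (W w * N w)) - 2 * a (k * m)%N * Ex (k * m) N + Ex (k * m) (fun w => N w ^+ 2).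
      by rewrite word_meanD word_meanB word_meanD !word_meanZ.
    by rewrite /N word_meanB word_mean_cst// NE subrr mulr0 subr0.
  by move: Nvar Ncov; rewrite /=; lra.
have m0 : 0 < m%:R :> R by rewrite ltr0n.
by move=> h; rewrite -(pmulr_lgt0 _ m0); exact: lt_le_trans h.
Qed.

End Nondegeneracy.

(** * The normal distribution function *)

Section Gaussian.
Variable R : realType.
Implicit Types x y b r : R.

Definition gauss_cdf x : R := fine (normal_prob 0 1 `]-oo, x]%classic).
Local Notation Phi := gauss_cdf.
Local Notation phi := (normal_pdf (0 : R) 1).

Lemma gauss_cdfE x : normal_prob 0 1 `]-oo, x]%classic = (Phi x)%:E.
Proof. by rewrite fineK// fin_num_measure. Qed.

Lemma is_derive_gauss_cdf x : is_derive x 1 Phi (phi x).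
Proof.
have int : lebesgue_measure.-integrable [set` `]-oo, (x + 1)]] (EFin \o phi).
  by apply: (integrableS _ _ (subsetT _)) => //; exact: integrable_normal_pdf.
have xlt : x < x + 1 by rewrite ltrDl.
have [|] := continuous_FTC1 xlt int (ltNyr _).
  exact: continuous_normal_pdf.
by move=> dF dE; split => //; rewrite -dE derive1E.
Qed.

Lemma gauss_cdf_ge0 x : 0 <= Phi x.
Proof. by rewrite fine_ge0. Qed.

Lemma gauss_cdf_le1 x : Phi x <= 1.
Proof. by rewrite -lee_fin -gauss_cdfE probability_le1. Qed.

Lemma gauss_cdf_homo : {homo Phi : x y / x <= y}.
Proof.
move=> x y xy; rewrite -lee_fin -!gauss_cdfE le_measure ?inE//.
by apply: subset_itvl.
Qed.

Let idR : measurableTypeR R -> R := idfun.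

#[local] HB.instance Definition _ :=
  @isMeasurableFun.Build _ _ _ _ idR (@measurable_id _ _ setT).

Lemma gauss_cdf_tail (e : R) : 0 < e ->
  exists2 t, 0 < t & Phi (- t) <= e /\ 1 - e <= Phi t.
Proof.
move=> e0.
pose X : {RV (normal_prob (0 : R) 1) >-> R} := idR.
have XE : Phi = fine \o cdf X by apply/funext.
have lim1 : Phi t @[t --> +oo] --> (1 : R) by rewrite XE; exact/fine_cvg/cvg_cdfy1.
have lim0 : Phi t @[t --> -oo] --> (0 : R) by rewrite XE; exact/fine_cvg/cvg_cdfNy0.
have lt1 : 1 - e < 1 by rewrite ltrBlDr ltrDl.
have /cvgr_ge/(_ _ lt1)[A [_ HA]] := lim1.
have /cvgr_le/(_ _ e0)[B [_ HB]] := lim0.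
pose t := Num.max 1 (Num.max (A + 1) (1 - B)).
have t1 : 1 <= t by rewrite le_max lexx.
have tA : A + 1 <= t by rewrite !le_max lexx orbT.
have tB : 1 - B <= t by rewrite !le_max lexx !orbT.
exists t; first by lra.
by split; [apply: HB; lra | apply: HA; lra].
Qed.

Lemma gauss_pdfE x : phi x = normal_peak 1 * expR (- x ^+ 2 / 2).
Proof.
rewrite normal_pdfE ?oner_eq0//= /normal_fun subr0 expr1n.
by congr (_ * expR (_ / _)); rewrite mulr2n.
Qed.

Lemma is_derive_gauss_pdf x : is_derive x 1 phi (- (x * phi x)).
Proof.
rewrite [X in is_derive _ _ X](_ : _ =
  (fun t : R => normal_peak 1 * expR (- t ^+ 2 / 2))); last first.
  by apply/funext => t; rewrite gauss_pdfE.
rewrite gauss_pdfE; apply: is_derive_eq.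
by rewrite /GRing.scale /=; lra.
Qed.

(* exp(-x^2/2) <= (1 + x^2/4)^-2 is at most a constant over 1 + |x|^3. *)
Lemma gauss_pdf_poly_bound :
  exists2 C : R, 0 <= C & forall x, (1 + `|x| ^+ 3) * phi x <= C.
Proof.
exists (normal_peak 1 * 9); first by rewrite mulr_ge0// normal_peak_ge0.
move=> x; rewrite gauss_pdfE mulrCA ler_wpM2l ?normal_peak_ge0//.
have -> : - x ^+ 2 / 2 = - (x ^+ 2 / 4) - x ^+ 2 / 4 by lra.
rewrite expRD expRN -invfM ler_pdivrMr ?mulr_gt0 ?expR_gt0//.
have x2 : x ^+ 2 = `|x| ^+ 2 by rewrite real_normK ?num_real.
have y0 := normr_ge0 x; move: (`|x|) x2 y0 => y -> y0.
have h : 1 + y ^+ 2 / 4 <= expR (y ^+ 2 / 4) by exact: expR_ge1Dx.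
apply: (@le_trans _ _ (9 * ((1 + y ^+ 2 / 4) * (1 + y ^+ 2 / 4)))); last first.
  by rewrite ler_pM2l// ler_pM//; nra.
have := sqr_ge0 (y ^+ 2 - y); have := sqr_ge0 (y ^+ 2); have := sqr_ge0 y; nra.
Qed.

Lemma mean_value_bound (f df : R -> R) (B u v : R) :
  (forall t : R, u <= t <= v -> is_derive t 1 f (df t)) -> u <= v ->
  (forall t, u <= t <= v -> `|df t| <= B) -> `|f v - f u| <= B * (v - u).
Proof.
move=> fd uv dfB.
have [||c cuv ->] := @MVT_segment R f df u v uv.
- by move=> t; rewrite in_itv/= => /andP[/ltW ut /ltW tv]; apply: fd; rewrite ut.
- apply: derivable_within_continuous => t; rewrite in_itv/= => /fd fdt.
  exact: ex_derive.
- by rewrite normrM (ger0_norm (_ : 0 <= v - u)) ?subr_ge0// ler_wpM2r ?subr_ge0// dfB.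
Qed.

Lemma mean_value_bound0 (f df : R -> R) (B y : R) :
  (forall t : R, is_derive t 1 f (df t)) -> f 0 = 0 ->
  (forall t, `|t| <= `|y| -> `|df t| <= B) -> `|f y| <= B * `|y|.
Proof.
move=> fd f0 dfB; have [y0|y0] := lerP 0 y.
  have := @mean_value_bound f df B 0 y (fun t _ => fd t) y0; rewrite f0 !subr0.
  rewrite (ger0_norm y0); apply=> t /andP[t0 ty]; apply: dfB.
  by rewrite !ger0_norm.
have := @mean_value_bound f df B y 0 (fun t _ => fd t) (ltW y0).
rewrite f0 !sub0r normrN (ltr0_norm y0); apply=> t /andP[ty t0]; apply: dfB.
by rewrite !ler0_norm ?lerN2// ltW.
Qed.

Lemma is_derive_reflect (f : R -> R) b s (d : R) :
  is_derive (b - s) 1 f d -> is_derive s 1 (fun x => f (b - x)) (- d).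
Proof.
move=> fd; have bd : is_derive s 1 (fun x : R => b - x) (-1).
  by apply: is_derive_eq; lra.
rewrite -mulrN1; exact: (@is_derive1_comp _ f (fun x => b - x) s _ _ fd bd).
Qed.

(** The third derivative is bounded uniformly by [gauss_pdf_poly_bound]; three applications of the
    mean value bound, to functions vanishing at 0, integrate this up to the remainder. *)
Lemma gauss_cdf_taylor : exists2 C : R, 0 <= C & forall b y,
  `|Phi (b - y) - Phi b + phi b * y + b * phi b * y ^+ 2 / 2| <= C * `|y| ^+ 3.
Proof.
have [C C0 HC] := gauss_pdf_poly_bound; exists (2 * C); first by rewrite mulr_ge0.
move=> b y.
have psi' (t : R) : is_derive t 1 (fun x => x * phi x) ((1 - t ^+ 2) * phi t).
  have ? := is_derive_gauss_pdf t.
  by apply: is_derive_eq; rewrite /GRing.scale/=; ring.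
have d2 t : `|b * phi b - (b - t) * phi (b - t)| <= 2 * C * `|t|.
  apply: (@mean_value_bound0 (fun s => b * phi b - (b - s) * phi (b - s))
    (fun s => (1 - (b - s) ^+ 2) * phi (b - s))).
  - move=> s.
    have ? : is_derive s 1 (fun x : R => (b - x) * phi (b - x)) (- ((1 - (b - s) ^+ 2) * phi (b - s))).
      exact: is_derive_reflect.
    by apply: is_derive_eq; ring.
  - by rewrite subr0 subrr.
  - move=> s _; have := HC (b - s); have := normal_pdf_ge0 0 1 (b - s).
    move: (b - s) => x p0 Hx; rewrite normrM (ger0_norm p0).
    apply: le_trans (_ : 2 * ((1 + `|x| ^+ 3) * phi x) <= _); last by lra.
    rewrite mulrA ler_wpM2r//; apply: (le_trans (ler_normB _ _)).
    rewrite normr1 normrX; have := normr_ge0 x; move: (`|x|) => z z0.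
    by have := sqr_ge0 (z - 1); nra.
have d1 t : `|- phi (b - t) + phi b + b * phi b * t| <= 2 * C * `|t| ^+ 2.
  rewrite expr2 mulrA; apply: (@mean_value_bound0 (fun t => - phi (b - t) + phi b + b * phi b * t) (fun s => b * phi b - (b - s) * phi (b - s))).
  - move=> s.
    have ? : is_derive s 1 (fun x : R => phi (b - x)) (- - ((b - s) * phi (b - s))).
      exact/is_derive_reflect/is_derive_gauss_pdf.
    by apply: is_derive_eq; rewrite /GRing.scale/=; ring.
  - by rewrite subr0 mulr0 addr0 addNr.
  - by move=> s st; apply: le_trans (d2 _) _; rewrite ler_wpM2l// mulr_ge0.
have -> : 2 * C * `|y| ^+ 3 = 2 * C * `|y| ^+ 2 * `|y| by ring.
apply: (@mean_value_bound0
  (fun y => Phi (b - y) - Phi b + phi b * y + b * phi b * y ^+ 2 / 2)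
  (fun t => - phi (b - t) + phi b + b * phi b * t)).
- move=> s.
  have ? : is_derive s 1 (fun x : R => Phi (b - x)) (- phi (b - s)).
    exact/is_derive_reflect/is_derive_gauss_cdf.
  by apply: is_derive_eq; rewrite /GRing.scale/=; lra.
- by rewrite subr0 subrr expr0n/= !(mulr0,mul0r,addr0).
- move=> s st; apply: le_trans (d1 _) _; rewrite ler_wpM2l// ?mulr_ge0//.
  by rewrite ler_sqr ?nnegrE.
Qed.

(** To first order, dividing [b] by [r] acts like averaging over a small centred shift of variance
    r^2 - 1: the linear term equals the mean of the quadratic term in [gauss_cdf_taylor]. *)
Lemma gauss_cdf_scale_taylor : exists2 C : R, 0 <= C & forall b r, 1 <= r ->
  `|Phi (b / r) - Phi b + b * phi b * (r ^+ 2 - 1) / 2| <= C * (r ^+ 2 - 1) ^+ 2.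
Proof.
have [C C0 HC] := gauss_pdf_poly_bound; exists (4 * C); first by rewrite mulr_ge0.
move=> b r r1.
(* The derivative of Phi(b / x) is - x Q(x), and Q(1) = b phi(b). Hence [F] below has derivative x
   (Q(1) - Q(x)), which is small near 1 because [Q] is Lipschitz. *)
pose Q x := b / x * phi (b / x) * x^-1 ^+ 2.
have inv' (x : R) : 1 <= x -> is_derive x 1 (fun x => b / x) (- (b / x ^+ 2)).
  move=> x1; have x0 : x != 0 by lra.
  have ? : is_derive x 1 (fun y : R => y^-1) _ := is_deriveV x0 (is_derive_id _ _).
  by apply: is_derive_eq; rewrite /GRing.scale/=; field.
have Q' (x : R) : 1 <= x -> is_derive x 1 Q
    ((- 3 * (b / x) + (b / x) ^+ 3) * phi (b / x) / x ^+ 3).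
  move=> x1; have x0 : x != 0 by lra.
  have ? := inv' x x1.
  have ? : is_derive x 1 (fun y : R => phi (b / y)) (- (b / x * phi (b / x)) * - (b / x ^+ 2)).
    exact: (@is_derive1_comp _ phi (fun y => b / y) x _ _ (is_derive_gauss_pdf _)).
  have ? : is_derive x 1 (fun y : R => y^-1) _ := is_deriveV x0 (is_derive_id _ _).
  by apply: is_derive_eq; rewrite /GRing.scale/=; field.
have Qlip x : 1 <= x -> `|Q x - Q 1| <= 4 * C * (x - 1).
  move=> x1; apply: (mean_value_bound _ x1) => [t /andP[t1 _]|t /andP[t1 _]].
    exact: Q'.
  have t0 : 0 < t by lra.
  have t3 : 0 < t ^+ 3 by rewrite exprn_gt0.
  rewrite normrM (ger0_norm (_ : 0 <= (t ^+ 3)^-1)); last by rewrite invr_ge0 ltW.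
  rewrite ler_pdivrMr//.
  apply: (@le_trans _ _ (4 * C)); last first.
    by rewrite ler_peMr ?mulr_ge0// exprn_ege1.
  have := HC (b / t); have := normal_pdf_ge0 0 1 (b / t).
  move: (b / t) => w p0 Hw; rewrite normrM (ger0_norm p0).
  apply: le_trans (_ : 4 * ((1 + `|w| ^+ 3) * phi w) <= _); last by lra.
  rewrite mulrA ler_wpM2r//; apply: (le_trans (ler_normD _ _)).
  rewrite normrM normrX normrN (ger0_norm (_ : 0 <= 3))//.
  have := normr_ge0 w; move: (`|w|) => z z0.
  by have := sqr_ge0 (z - 1); nra.
pose F x := Phi (b / x) + b * phi b * (x ^+ 2 - 1) / 2.
have F' (x : R) : 1 <= x -> is_derive x 1 F (x * (Q 1 - Q x)).
  move=> x1; have x0 : x != 0 by lra.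
  have ? := inv' x x1.
  have ? : is_derive x 1 (fun y : R => Phi (b / y)) (phi (b / x) * - (b / x ^+ 2)).
    exact: (@is_derive1_comp _ Phi (fun y => b / y) x _ _ (is_derive_gauss_cdf _)).
  by apply: is_derive_eq; rewrite /GRing.scale/= /Q divr1 invr1; field.
have : `|F r - F 1| <= r * (4 * C * (r - 1)) * (r - 1).
  apply: (@mean_value_bound F (fun x => x * (Q 1 - Q x)) _ 1 r) => //.
    by move=> t /andP[t1 _]; apply: F'.
  move=> t /andP[t1 tr]; rewrite normrM ger0_norm; last by lra.
  rewrite ler_pM//; first by lra.
  by rewrite distrC; apply: le_trans (Qlip t t1) _; rewrite ler_wpM2l ?mulr_ge0//; lra.
rewrite /F divr1 expr1n subrr mulr0 mul0r addr0.
rewrite [X in `|X|](_ : _ = Phi (b / r) - Phi b + b * phi b * (r ^+ 2 - 1) / 2); last by ring.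
move=> /le_trans; apply.
have -> : 4 * C * (r ^+ 2 - 1) ^+ 2 = 4 * C * ((r - 1) ^+ 2 * (r + 1) ^+ 2) by ring.
have -> : r * (4 * C * (r - 1)) * (r - 1) = 4 * C * ((r - 1) ^+ 2 * r) by ring.
by rewrite ler_wpM2l ?mulr_ge0// ler_wpM2l ?sqr_ge0//; nra.
Qed.

End Gaussian.

(** * Central limit theorem for quasi-additive functions *)

Section CentralLimit.
Variables (R : realType) (A : finType) (W : seq A -> R) (K : R).
Implicit Types (n m k l r : nat) (u v w : seq A).
Hypothesis A0 : (0 < #|A|)%N.
Hypothesis W_nil : W [::] = 0.
Hypothesis WD : forall u v, `|W (u ++ v) - W u - W v| <= K.

Local Notation Ex := (@word_mean R A).
Local Notation a n := (Ex n W).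
Local Notation X n w := (W w - a n).
Local Notation var n := (Ex n (fun w => X n w ^+ 2)).
Local Notation mom4 n := (Ex n (fun w => X n w ^+ 4)).
Local Notation Phi := (@gauss_cdf R).

(** The mean of [g] at [s] plus k independent centred block weights. One block is consumed at a
    time, as in Lindeberg's replacement argument. *)
Fixpoint block_mean l k (g : R -> R) s : R :=
  if k is k'.+1 then Ex l (fun w => block_mean l k' g (s + X l w)) else g s.

(** Each cut changes the weight by at most K and the r leftover letters by at most L r. As [g] is
    decreasing, shifting [s] by the total error bounds the mean from both sides. *)
Lemma block_mean_sandwich L : (forall w, `|W w| <= L * (size w)%:R) ->
  forall (g : R -> R) l k r s, (forall x y, x <= y -> g y <= g x) ->
  block_mean l k g (s + (k%:R * K + L * r%:R)) <=
    Ex (k * l + r) (fun w => g (s + W w - k%:R * a l)) <=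
  block_mean l k g (s - (k%:R * K + L * r%:R)).
Proof.
move=> WL g l k r s g_anti.
elim: k s => [|k IH] s.
  rewrite mul0n add0n /= !mul0r add0r.
  have Wr w : size w = r -> - (L * r%:R) <= W w <= L * r%:R.
    by move=> sw; rewrite -ler_norml -sw.
  apply/andP; split; [rewrite -[leLHS](word_mean_cst A0 r)|rewrite -[leRHS](word_mean_cst A0 r)];
    by apply: ler_word_mean => w /Wr/andP[h1 h2]; apply: g_anti; lra.
rewrite mulSn -addnA word_mean_cat.
apply/andP; split; apply: ler_word_mean => u su.
- have /andP[h _] := IH (s + K + X l u).
  rewrite (_ : s + (k.+1%:R * K + L * r%:R) + X l u = s + K + X l u + (k%:R * K + L * r%:R)); last by rewrite -natr1; ring.
  apply: le_trans h _; apply: ler_word_mean => v _; apply: g_anti.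
  by have := WD u v; rewrite ler_norml -natr1 => /andP[]; lra.
- have /andP[_ h] := IH (s - K + X l u).
  rewrite (_ : s - (k.+1%:R * K + L * r%:R) + X l u = s - K + X l u - (k%:R * K + L * r%:R)); last by rewrite -natr1; ring.
  apply: le_trans h; apply: ler_word_mean => v _; apply: g_anti.
  by have := WD u v; rewrite ler_norml -natr1 => /andP[]; lra.
Qed.

(** The two Taylor expansions agree up to second order, since the block weight is centred. The third
    moment is controlled by |y|^3 <= mu y^2 + y^4 / mu, with [mu] left free. *)
Lemma one_block_gauss : exists2 C, 0 <= C & forall l sigma mu b, 0 < sigma -> 0 < mu ->
  `|Ex l (fun w => Phi (b - X l w / sigma)) - Phi (b / Num.sqrt (1 + var l / sigma ^+ 2))|
  <= C * (mu * (var l / sigma ^+ 2) + mom4 l / sigma ^+ 4 / mu + (var l / sigma ^+ 2) ^+ 2).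
Proof.
have [C1 C10 H1] := gauss_cdf_taylor R; have [C2 C20 H2] := gauss_cdf_scale_taylor R.
exists (C1 + C2) => [|l sigma mu b sigma0 mu0]; first by rewrite addr_ge0.
have var_ge0 : 0 <= var l.
  by rewrite -(word_mean_cst A0 l 0); apply: ler_word_mean => w _; exact: sqr_ge0.
pose y w : R := X l w / sigma.
have y2 : Ex l (fun w => y w ^+ 2) = var l / sigma ^+ 2.
  by rewrite mulrC -word_meanZ; apply: eq_word_mean => w _; rewrite /y expr_div_n mulrC.
have y4 : Ex l (fun w => y w ^+ 4) = mom4 l / sigma ^+ 4.
  by rewrite mulrC -word_meanZ; apply: eq_word_mean => w _; rewrite /y expr_div_n mulrC.
have y1 : Ex l y = 0.
  rewrite (_ : 0 = sigma^-1 * Ex l (fun w => X l w)); last by rewrite word_mean_centered// mulr0.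
  by rewrite -word_meanZ; apply: eq_word_mean => w _; rewrite /y mulrC.
rewrite -y4; set s := var l / sigma ^+ 2 in y2 *.
have s0 : 0 <= s by rewrite divr_ge0// exprn_ge0// ltW.
have r1 : 1 <= Num.sqrt (1 + s) by rewrite -[leLHS]sqrtr1 ler_wsqrtr// lerDl.
have := H2 b _ r1; rewrite sqr_sqrtr; last by rewrite addr_ge0.
rewrite (_ : 1 + s - 1 = s); last by ring.
set Ps := Phi (b / _) => h2.
pose T w := Phi (b - y w) - Phi b + normal_pdf 0 1 b * y w + b * normal_pdf 0 1 b * y w ^+ 2 / 2.
have ET : Ex l T = Ex l (fun w => Phi (b - y w)) - Phi b + b * normal_pdf 0 1 b * s / 2.
  transitivity (Ex l (fun w => Phi (b - y w)) - Phi b + normal_pdf 0 1 b * Ex l y + b * normal_pdf 0 1 b / 2 * Ex l (fun w => y w ^+ 2)).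
    rewrite -!word_meanZ -[Phi b in RHS](word_mean_cst A0 l) -word_meanB -!word_meanD.
    by apply: eq_word_mean => w _; rewrite /T; ring.
  by rewrite y1 y2; ring.
have y3 : Ex l (fun w => `|y w| ^+ 3) <= mu * s + Ex l (fun w => y w ^+ 4) / mu.
  rewrite -y2 -word_meanZ mulrC -word_meanZ -word_meanD; apply: ler_word_mean => w _.
  have -> : y w ^+ 2 = `|y w| ^+ 2 by rewrite real_normK ?num_real.
  have -> : y w ^+ 4 = `|y w| ^+ 4 by rewrite -normrX ger0_norm// exprn_even_ge0.
  have := normr_ge0 (y w); move: (`|y w|) => z z0.
  have -> : mu * z ^+ 2 + mu^-1 * z ^+ 4 = (mu ^+ 2 * z ^+ 2 + z ^+ 4) / mu.
    by field; rewrite gt_eqF.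
  rewrite ler_pdivlMr//.
  by have := sqr_ge0 (z * (z - mu)); have := sqr_ge0 (z * z); have := sqr_ge0 (mu * z); nra.
have h1 : `|Ex l T| <= C1 * (mu * s + Ex l (fun w => y w ^+ 4) / mu).
  apply: (@le_trans _ _ (C1 * Ex l (fun w => `|y w| ^+ 3))); last by rewrite ler_wpM2l.
  rewrite -(word_meanZ l C1); apply: (le_trans (ler_norm_word_mean _ _)).
  by apply: ler_word_mean => w _; exact: H1.
rewrite (_ : _ - Ps = Ex l T - (Ps - Phi b + b * normal_pdf 0 1 b * s / 2)); last by rewrite ET /y; ring.
apply: le_trans (ler_normB _ _) _; apply: le_trans (lerD h1 h2) _.
have q0 : 0 <= mu * s + Ex l (fun w => y w ^+ 4) / mu.
  apply: le_trans y3; rewrite -(word_mean_cst A0 l 0); apply: ler_word_mean => w _.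
  by rewrite exprn_ge0.
by move: (mu * s + _ / mu) q0 => q q0; have := sqr_ge0 s; nra.
Qed.

(** Averaging over a block keeps the test function in the Gaussian family and only increases its
    variance, so every one of the k replacement errors is at most the error for the initial
    [sigma]. *)
Lemma block_mean_gauss : exists2 C, 0 <= C & forall l k sigma mu x s, 0 < sigma -> 0 < mu ->
  `|block_mean l k (fun t => Phi ((x - t) / sigma)) s -
    Phi ((x - s) / Num.sqrt (sigma ^+ 2 + k%:R * var l))| <=
  k%:R * (C * (mu * (var l / sigma ^+ 2) + mom4 l / sigma ^+ 4 / mu + (var l / sigma ^+ 2) ^+ 2)).
Proof.
have [C C0 HC] := one_block_gauss; exists C => // l k sigma mu x s sigma0 mu0.
have var_ge0 : 0 <= var l.
  by rewrite -(word_mean_cst A0 l 0); apply: ler_word_mean => w _; exact: sqr_ge0.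
have mom4_ge0 : 0 <= mom4 l.
  by rewrite -(word_mean_cst A0 l 0); apply: ler_word_mean => w _; rewrite exprn_even_ge0.
set err := C * _.
elim: k s => [|k IH] s; first by rewrite /= !mul0r addr0 sqrtr_sqr (gtr0_norm sigma0) subrr normr0.
set g := fun t => _ in IH *.
pose sk := Num.sqrt (sigma ^+ 2 + k%:R * var l).
have sk2 : sk ^+ 2 = sigma ^+ 2 + k%:R * var l by rewrite sqr_sqrtr// addr_ge0 ?sqr_ge0// mulr_ge0.
have sksigma : sigma <= sk.
  by rewrite -[leLHS](gtr0_norm sigma0) -sqrtr_sqr ler_wsqrtr// lerDl mulr_ge0.
have sk0 : 0 < sk by exact: lt_le_trans sksigma.
pose b := (x - s) / sk.
have bE : (x - s) / Num.sqrt (sigma ^+ 2 + k.+1%:R * var l) = b / Num.sqrt (1 + var l / sk ^+ 2).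
  rewrite /b -mulrA -invfM; congr (_ / _).
  rewrite -{1}(gtr0_norm sk0) -sqrtr_sqr -sqrtrM ?sqr_ge0//; congr Num.sqrt.
  by rewrite mulrDr mulr1 mulrCA mulfV ?mulr1 ?sk2 -?natr1; [ring | rewrite -sk2 expf_neq0// gt_eqF].
rewrite bE /=.
have -> : Ex l (fun w => block_mean l k g (s + X l w)) - Phi (b / Num.sqrt (1 + var l / sk ^+ 2)) =
  Ex l (fun w => block_mean l k g (s + X l w) - Phi (b - X l w / sk)) +
  (Ex l (fun w => Phi (b - X l w / sk)) - Phi (b / Num.sqrt (1 + var l / sk ^+ 2))).
  by rewrite word_meanB; ring.
apply: le_trans (ler_normD _ _) _; rewrite -natr1 mulrDl mul1r; apply: lerD.
  apply: word_mean_bound => // w _; have := IH (s + X l w); rewrite -/sk.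
  by rewrite (_ : (x - (s + X l w)) / sk = b - X l w / sk)// /b; field; rewrite gt_eqF.
apply: le_trans (HC l sk mu b sk0 mu0) _; rewrite /err ler_wpM2l//.
have sV (i : nat) : (sk ^+ i)^-1 <= (sigma ^+ i)^-1.
  by rewrite lef_pV2 ?posrE ?exprn_gt0// lerXn2r// nnegrE ltW.
have vs : var l / sk ^+ 2 <= var l / sigma ^+ 2 by rewrite ler_wpM2l.
have vs0 : 0 <= var l / sk ^+ 2 by rewrite divr_ge0// exprn_ge0// ltW.
apply: lerD; first apply: lerD.
- by rewrite ler_wpM2l// ltW.
- by rewrite ler_wpM2r ?invr_ge0 ?(ltW mu0)// ler_wpM2l.
- by rewrite lerXn2r// nnegrE// (le_trans vs0).
Qed.

Lemma gauss_cdf_scale_continuous (x e : R) : 0 < e -> exists2 d, 0 < d <= 1 &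
  forall p q, `|p - x| <= d -> `|q - 1| <= d -> `|Phi (p / Num.sqrt q) - Phi x| <= e.
Proof.
move=> e0.
have Phic : {for x, continuous Phi}.
  apply: differentiable_continuous; apply/derivable1_diffP.
  by have := is_derive_gauss_cdf x => ?; apply: ex_derive.
have /cvgrPdist_le/(_ _ e0)/nbhs_ballP[d' /= d'0 Hd'] := Phic.
have x0 : 0 < 2 * (1 + `|x|) by have := normr_ge0 x; lra.
pose d := Num.min (1 / 2) (d' / 2 / (2 * (1 + `|x|))).
have d0 : 0 < d by rewrite lt_min !divr_gt0//.
have dh : d <= 1 / 2 by rewrite ge_min lexx.
have dd' : d * (2 * (1 + `|x|)) <= d' / 2 by rewrite -ler_pdivlMr// ge_min lexx orbT.
exists d => [|p q px q1]; first by rewrite d0; lra.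
rewrite distrC; apply: Hd'; rewrite /ball/=.
have qh : 1 / 2 <= q by move: q1; rewrite ler_norml => /andP[]; lra.
have sq : 1 / 2 <= Num.sqrt q.
  by rewrite -[leLHS]ger0_norm// -sqrtr_sqr ler_wsqrtr//; lra.
have s1 : `|Num.sqrt q - 1| <= d.
  have -> : Num.sqrt q - 1 = (q - 1) / (Num.sqrt q + 1).
    have qq : Num.sqrt q ^+ 2 = q by rewrite sqr_sqrtr//; lra.
    by rewrite -{2}qq; field; lra.
  rewrite normrM (ger0_norm (_ : 0 <= _^-1)); last by rewrite invr_ge0; lra.
  rewrite ler_pdivrMr; last by lra.
  by apply: le_trans q1 _; rewrite ler_peMr; lra.
rewrite distrC (_ : p / Num.sqrt q - x = ((p - x) - x * (Num.sqrt q - 1)) / Num.sqrt q); last by field; lra.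
rewrite normrM (ger0_norm (_ : 0 <= _^-1)); last by rewrite invr_ge0; lra.
rewrite ltr_pdivrMr; last by lra.
apply: le_lt_trans (ler_normB _ _) _; rewrite normrM.
have : `|x| * `|Num.sqrt q - 1| <= `|x| * d by rewrite ler_wpM2l.
have := normr_ge0 x.
by nra.
Qed.

Section Limit.
Variables (E V K' K2 C4 : R).
Hypothesis mean_E : forall n, `|a n - E * n%:R| <= K'.
Hypothesis V_gt0 : 0 < V.
Hypothesis var_V : forall n, `|var n - V * n%:R| <= K2.
Hypothesis mom4_le : forall n, mom4 n <= C4 * n%:R ^+ 2.

Local Notation N n := (Num.sqrt (V * n%:R)).

(** As l <= n / k and n = O(sigma^2), a block has normalised variance O(1/k) and normalised fourth
    moment O(1/k^2). The k errors add up to O(mu) + O(1/(k mu)) + O(1/k), so [mu] is chosen first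
    and [k] afterwards, both independent of n. *)
Lemma block_error (c e : R) : 0 < c -> 0 < e -> exists2 k, (0 < k)%N &
  exists2 mu : R, 0 < mu & forall l n (sigma : R), 0 < sigma -> (k * l <= n)%N ->
    n%:R <= c * sigma ^+ 2 -> forall x s,
  `|block_mean l k (fun t => Phi ((x - t) / sigma)) s -
    Phi ((x - s) / Num.sqrt (sigma ^+ 2 + k%:R * var l))| <= e.
Proof.
move=> c0 e0; have [C C0 HC] := block_mean_gauss.
have K20 : 0 <= K2 by apply: le_trans (var_V 0%N).
have C40 : 0 <= C4.
  have := mom4_le 1; rewrite expr1n mulr1; apply: le_trans.
  by rewrite -(word_mean_cst A0 1 0); apply: ler_word_mean => w _; rewrite exprn_even_ge0.
pose V1 := V + K2; have V0 := V_gt0; have V10 : 0 <= V1 by rewrite /V1; lra.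
have var_le l : var l <= V1 * l%:R.
  case: l => [|l]; first by rewrite mulr0 /= subrr expr0n.
  have := var_V l.+1; rewrite ler_distl => /andP[_ h].
  have l1 : 1 <= l.+1%:R :> R by rewrite ler1n.
  by rewrite /V1; nra.
have var_ge0 l : 0 <= var l.
  by rewrite -(word_mean_cst A0 l 0); apply: ler_word_mean => w _; exact: sqr_ge0.
pose mu := e / 2 / (C * (V1 * c) + 1).
have CVc : 0 <= C * (V1 * c) by rewrite mulr_ge0// mulr_ge0// ltW.
have mu0 : 0 < mu by rewrite divr_gt0//; lra.
pose B := C * (C4 * c ^+ 2 / mu + (V1 * c) ^+ 2).
have B0 : 0 <= B.
  by rewrite mulr_ge0// addr_ge0 ?sqr_ge0// divr_ge0 ?(ltW mu0)// mulr_ge0 ?sqr_ge0.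
pose k := (Num.truncn (B / (e / 2))).+1.
have kB : B <= k%:R * (e / 2).
  by rewrite -ler_pdivrMr ?ltW ?truncnS_gt//; lra.
exists k => //; exists mu => // l n sigma sigma0 kln nc x s.
apply: le_trans (HC l k sigma mu x s sigma0 mu0) _.
have s20 : 0 < sigma ^+ 2 by rewrite exprn_gt0.
have k0 : 0 < k%:R :> R by rewrite ltr0n.
have lk : l%:R <= c / k%:R * sigma ^+ 2.
  rewrite mulrAC ler_pdivlMr// mulrC -natrM; apply: le_trans nc; by rewrite ler_nat.
have h1 : var l / sigma ^+ 2 <= V1 * (c / k%:R).
  rewrite ler_pdivrMr//; apply: le_trans (var_le l) _; rewrite -mulrA ler_wpM2l//.
have h10 : 0 <= var l / sigma ^+ 2 by rewrite divr_ge0// ltW.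
have h2 : mom4 l / sigma ^+ 4 <= C4 * (c / k%:R) ^+ 2.
  rewrite ler_pdivrMr ?exprn_gt0//; apply: le_trans (mom4_le l) _.
  rewrite -mulrA ler_wpM2l// (_ : _ * sigma ^+ 4 = (c / k%:R * sigma ^+ 2) ^+ 2); last by ring.
  by rewrite lerXn2r// nnegrE// (le_trans _ lk).
apply: (@le_trans _ _ (k%:R * (C * (mu * (V1 * (c / k%:R)) + C4 * (c / k%:R) ^+ 2 / mu + (V1 * (c / k%:R)) ^+ 2)))).
  rewrite ler_pM2l// ler_wpM2l//; apply: lerD; first apply: lerD.
  - by rewrite ler_pM2l.
  - by rewrite ler_pM2r// invr_gt0.
  - by rewrite lerXn2r// nnegrE// (le_trans h10).
rewrite (_ : k%:R * _ = mu * (C * (V1 * c)) + B / k%:R); last first.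
  by rewrite /B; field; rewrite ?gt_eqF.
have : B / k%:R <= e / 2 by rewrite ler_pdivrMr// mulrC.
have : mu * (C * (V1 * c)) <= e / 2.
  rewrite /mu mulrAC ler_pdivrMr; last by lra.
  by rewrite ler_pM2l; lra.
by lra.
Qed.

(** The smoothing adds eps^2 to the normalised variance. The number of blocks is fixed before n
    grows, so the errors from cutting and recentring are bounded and become negligible after
    normalisation. *)
Lemma smoothed_clt (x e : R) : 0 < e -> exists2 d, 0 < d <= 1 &
  forall eps, 0 < eps -> eps ^+ 2 <= d -> exists n0, forall n, (n0 <= n)%N ->
  forall eta, `|eta| <= d ->
  `|Ex n (fun w => Phi ((x + eta - (W w - E * n%:R) / N n) / eps)) - Phi x| <= e.
Proof.
move=> e0; have e2 : 0 < e / 2 by lra.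
have [d0 /andP[d00 d01] Hd] := gauss_cdf_scale_continuous x e2.
exists (d0 / 2) => [|eps eps0 epsd]; first by apply/andP; split; lra.
set d := d0 / 2 in epsd *; have d_gt0 : 0 < d by rewrite /d; lra.
have eps20 : 0 < eps ^+ 2 by rewrite exprn_gt0.
have c0 : 0 < (eps ^+ 2 * V)^-1 by rewrite invr_gt0 mulr_gt0.
have [k k0 [mu mu0 Hk]] := block_error c0 e2.
have [L L0 WL] := quasi_additive_lipschitz W_nil WD.
have K0 := quasi_additive_const_ge0 WD.
have K'0 : 0 <= K' by apply: le_trans (mean_E 0%N).
have K20 : 0 <= K2 by apply: le_trans (var_V 0%N).
(* [c1] bounds the shift of the argument: per block K for the cut and K' for the mean, and L and |E|
   per leftover letter, of which there are at most k. Likewise [c2] bounds the difference between k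
   var l and V n. *)
pose c1 := k%:R * (K + L + K' + `|E|).
pose c2 := k%:R * (K2 + V).
have c10 : 0 <= c1 by rewrite mulr_ge0// addr_ge0// addr_ge0// addr_ge0.
have c20 : 0 <= c2 by rewrite mulr_ge0// addr_ge0// ltW.
(* Once V n >= b, [c1] is at most d sqrt(V n), [c2] at most d V n, and V n is positive. *)
pose b := (c1 / d) ^+ 2 + c2 / d + 1.
exists (Num.truncn (b / V)).+1 => n nn0 eta etad.
have Vn : b <= V * n%:R.
  rewrite mulrC -ler_pdivrMr//; apply: le_trans (ltW (truncnS_gt _)) _.
  by rewrite ler_nat.
have cd0 : 0 <= c1 / d by rewrite divr_ge0// ltW.
have c2d0 : 0 <= c2 / d by rewrite divr_ge0// ltW.
have Vn0 : 0 < V * n%:R by apply: lt_le_trans Vn; rewrite /b; have := sqr_ge0 (c1 / d); lra.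
have Nn0 : 0 < N n by rewrite sqrtr_gt0.
have N2 : N n ^+ 2 = V * n%:R by rewrite sqr_sqrtr// ltW.
have c1N : c1 <= d * N n.
  rewrite mulrC -ler_pdivrMr// -[leLHS]ger0_norm// -sqrtr_sqr ler_wsqrtr//.
  by apply: le_trans Vn; rewrite /b; lra.
have c2N : c2 <= d * (V * n%:R).
  rewrite mulrC -ler_pdivrMr//.
  by apply: le_trans Vn; rewrite /b; have := sqr_ge0 (c1 / d); lra.
pose l := (n %/ k)%N; pose r := (n %% k)%N.
have nkl : n = (k * l + r)%N by rewrite mulnC -divn_eq.
have rk : r%:R <= k%:R :> R by rewrite ler_nat ltnW// ltn_mod.
have k1 : 1 <= k%:R :> R by rewrite ler1n.
pose sigma := eps * N n; have sigma0 : 0 < sigma by rewrite mulr_gt0.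
have nc : n%:R <= (eps ^+ 2 * V)^-1 * sigma ^+ 2.
  rewrite /sigma exprMn N2 le_eqVlt; apply/orP; left; apply/eqP.
  by field; rewrite ?gt_eqF.
have kln : (k * l <= n)%N by rewrite nkl leq_addr.
pose x' := (x + eta) * N n.
pose s0 := k%:R * a l - E * n%:R.
pose g t := Phi ((x' - t) / sigma).
have g_anti p q : p <= q -> g q <= g p.
  by move=> pq; apply: gauss_cdf_homo; rewrite ler_pM2r ?invr_gt0//; lra.
have EE : Ex n (fun w => Phi ((x + eta - (W w - E * n%:R) / N n) / eps)) =
    Ex (k * l + r) (fun w => g (s0 + W w - k%:R * a l)).
  rewrite {1 3}nkl; apply: eq_word_mean => w _; rewrite /g /s0; congr (Phi _).
  rewrite -nkl /x' /sigma; field; rewrite ?gt_eqF//.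
rewrite EE; set del := k%:R * K + L * r%:R.
have del0 : 0 <= del by rewrite addr_ge0// mulr_ge0.
have nE : n%:R = k%:R * l%:R + r%:R :> R by rewrite {1}nkl natrD natrM.
have s0c : `|s0| + del <= c1.
  have -> : s0 = k%:R * (a l - E * l%:R) - E * r%:R by rewrite /s0 nE; ring.
  have h1 : `|k%:R * (a l - E * l%:R)| <= k%:R * K'.
    by rewrite normrM ger0_norm// ler_wpM2l.
  have h2 : `|E * r%:R| <= k%:R * `|E| by rewrite normrM (ger0_norm (_ : 0 <= r%:R))// mulrC ler_wpM2r.
  have h3 : L * r%:R <= k%:R * L by rewrite mulrC ler_wpM2r.
  have := ler_normB (k%:R * (a l - E * l%:R)) (E * r%:R).
  by rewrite /del /c1; lra.
have vc : `|k%:R * var l - V * n%:R| <= c2.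
  have -> : k%:R * var l - V * n%:R = k%:R * (var l - V * l%:R) - V * r%:R by rewrite nE; ring.
  apply: le_trans (ler_normB _ _) _; rewrite (_ : c2 = k%:R * K2 + k%:R * V); last by rewrite /c2; ring.
  apply: lerD.
    by rewrite normrM ger0_norm// ler_wpM2l.
  by rewrite normrM !ger0_norm// ?(ltW V_gt0)// mulrC ler_wpM2r// ltW.
have close s : `|s - s0| <= del -> `|block_mean l k g s - Phi x| <= e.
  move=> sdel; rewrite (_ : _ - Phi x = (block_mean l k g s - Phi ((x' - s) / Num.sqrt (sigma ^+ 2 + k%:R * var l))) + (Phi ((x' - s) / Num.sqrt (sigma ^+ 2 + k%:R * var l)) - Phi x)); last by ring.
  apply: le_trans (ler_normD _ _) _; rewrite [leRHS](_ : e = e / 2 + e / 2); last by lra.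
  apply: lerD; first exact: (Hk l n sigma sigma0 kln nc).
  pose q := eps ^+ 2 + k%:R * var l / (V * n%:R).
  have q1 : `|q - 1| <= d0.
    have -> : q - 1 = eps ^+ 2 + (k%:R * var l - V * n%:R) / (V * n%:R).
      by rewrite /q mulrBl mulfV ?gt_eqF//; ring.
    apply: le_trans (ler_normD _ _) _; rewrite ger0_norm; last exact: ltW.
    rewrite [leRHS](_ : d0 = d + d); last by rewrite /d; lra.
    apply: lerD => //; rewrite normrM (gtr0_norm (_ : 0 < _^-1)) ?invr_gt0//.
    by rewrite ler_pdivrMr//; apply: le_trans vc _.
  have -> : Num.sqrt (sigma ^+ 2 + k%:R * var l) = N n * Num.sqrt q.
    rewrite -{1}(gtr0_norm Nn0) -sqrtr_sqr -sqrtrM ?sqr_ge0// N2; congr Num.sqrt.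
    rewrite /q /sigma exprMn N2; move: (V * n%:R) Vn0 => Z Z0.
    by field; rewrite gt_eqF.
  rewrite invfM mulrA; apply: Hd => //.
  rewrite (_ : _ - x = eta - s / N n); last by rewrite /x'; field; rewrite gt_eqF.
  apply: le_trans (ler_normB _ _) _; rewrite [leRHS](_ : d0 = d + d); last by rewrite /d; lra.
  apply: lerD => //; rewrite normrM (gtr0_norm (_ : 0 < _^-1)) ?invr_gt0//.
  rewrite ler_pdivrMr//; apply: le_trans c1N; apply: le_trans s0c.
  by rewrite -[s](subrK s0) addrC; apply: le_trans (ler_normD _ _) _; lra.
have /andP[lo up] := block_mean_sandwich WL l k r s0 g_anti.
have : `|block_mean l k g (s0 + del) - Phi x| <= e.
  by apply: close; rewrite addrAC subrr add0r ger0_norm.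
have : `|block_mean l k g (s0 - del) - Phi x| <= e.
  by apply: close; rewrite addrAC subrr add0r normrN ger0_norm.
rewrite !ler_distl => /andP[_ h1] /andP[h2 _]; apply/andP; split.
  by apply: le_trans lo; exact: h2.
by apply: le_trans up _; exact: h1.
Qed.

(** The indicator of y <= x lies, up to the tail e/2, between the smoothed steps centred at x - d
    and x + d. *)
Lemma word_clt (x e : R) : 0 < e -> exists n0, forall n, (n0 <= n)%N ->
  `|Ex n (fun w => ((W w - E * n%:R) / N n <= x)%R%:R) - Phi x| <= e.
Proof.
move=> e0; have e2 : 0 < e / 2 by lra.
have [d /andP[d0 d1] Hd] := smoothed_clt x e2.
have [t t0 [tN tP]] := gauss_cdf_tail e2.
(* With eps <= d / t a distance d becomes at least t after scaling, where the tail bounds hold; eps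
   <= d <= 1 gives eps^2 <= d. *)
pose eps := Num.min (d / t) d.
have eps0 : 0 < eps by rewrite lt_min divr_gt0.
have epsd : eps <= d by rewrite ge_min lexx orbT.
have epst : t * eps <= d by rewrite mulrC -ler_pdivlMr// ge_min lexx.
have eps2 : eps ^+ 2 <= d by nra.
have [n0 Hn] := Hd eps eps0 eps2; exists n0 => n /Hn H.
have := H d; rewrite gtr0_norm// => /(_ (lexx _)); rewrite ler_distl => /andP[_ up].
have := H (- d); rewrite normrN gtr0_norm// => /(_ (lexx _)); rewrite ler_distl => /andP[lo _].
rewrite ler_distl; apply/andP; split.
  apply: (@le_trans _ _ (Ex n (fun w => Phi ((x - d - (W w - E * n%:R) / N n) / eps)) - e / 2)).
    by lra.
  rewrite -[e / 2](word_mean_cst A0 n) -word_meanB; apply: ler_word_mean => w _.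
  set y := (W w - _) / _; have [yx|xy] := lerP y x.
    by have := gauss_cdf_le1 ((x - d - y) / eps); rewrite mulr1n; lra.
  rewrite mulr0n subr_le0; apply: le_trans tN; apply: gauss_cdf_homo.
  by rewrite ler_pdivrMr//; lra.
apply: (@le_trans _ _ (Ex n (fun w => Phi ((x + d - (W w - E * n%:R) / N n) / eps)) + e / 2)).
  rewrite -[e / 2](word_mean_cst A0 n) -word_meanD; apply: ler_word_mean => w _.
  set y := (W w - _) / _; have [yx|xy] := lerP y x; last first.
    by have := gauss_cdf_ge0 ((x + d - y) / eps); rewrite mulr0n; lra.
  rewrite mulr1n -lerBlDr; apply: le_trans tP _; apply: gauss_cdf_homo.
  by rewrite ler_pdivlMr//; lra.
by lra.
Qed.

End Limit.

End CentralLimit.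

(** * From random digits to word means *)

Lemma word_mean_tuple (R : realType) (A : finType) n (f : seq A -> R) :
  word_mean n f = \sum_(w : n.-tuple A) f w * #|A|%:R^-1 ^+ n.
Proof.
elim: n f => [|n IH] f.
  rewrite (big_pred1 [tuple]) ?expr0 ?mulr1// => w.
  by apply/esym/eqP; exact: tuple0.
rewrite /= (reindex (fun aw : A * n.-tuple A => [tuple of aw.1 :: aw.2]))/=; last first.
  exists (fun w => (thead w, [tuple of behead w])); [move=> [a w] _|move=> w _].
    by congr (_, _); apply: val_inj.
  by rewrite [RHS]tuple_eta; apply: val_inj.
rewrite -(pair_bigA _ (fun a (w : n.-tuple A) => f (a :: w) * #|A|%:R^-1 ^+ n.+1))/=.
rewrite mulr_sumr; apply: eq_bigr => a _; rewrite IH mulr_sumr; apply: eq_bigr => w _.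
by rewrite exprS mulrCA.
Qed.

Section Transfer.
Context {disp : measure_display} {T : measurableType disp} {R : realType}.
Variables (P : probability T R) (Y : choiceType) (A : {fset Y}) (n : nat).
Variable D : T -> n.-tuple Y.
Hypothesis D_iid : iid_uniform_digits P A D.

Let cylinder (w : n.-tuple A) := [set t | D t = map_tuple val w].

Let cylinderE w : cylinder w =
  \bigcap_(j in [set` [set: 'I_n]%SET]) ((fun t => tnth (D t) j) @^-1` [set val (tnth w j)]).
Proof.
apply/seteqP; split=> t /=; first by move=> Dw j _ /=; rewrite Dw tnth_map.
by move=> Dw; apply: eq_from_tnth => j; rewrite tnth_map; apply: Dw; rewrite /= inE.
Qed.

Let digits_in_alphabet t : exists w : n.-tuple A, D t = map_tuple val w.
Proof.
case: D_iid => DA _ _ _.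
exists (mktuple (fun j => [` DA t _ (mem_tnth j (D t))]%fset)).
by apply: eq_from_tnth => j; rewrite tnth_map tnth_mktuple.
Qed.

Let measurable_cylinder w : measurable (cylinder w).
Proof.
case: D_iid => _ meas _ _; rewrite cylinderE; apply: fin_bigcap_measurable => // j _.
exact: meas.
Qed.

Let probability_cylinder w : P (cylinder w) = (#|{: A}|%:R^-1 ^+ n)%:E.
Proof.
case: D_iid => _ _ indep unif; rewrite cylinderE indep.
transitivity (\prod_(j < n) (#|{: A}|%:R^-1 : R)%:E)%E.
  by apply: eq_big => [j|j _]; rewrite ?inE// unif ?cardfE// (valP (tnth w j)).
by rewrite prodEFin prodr_const card_ord.
Qed.

(** The random word takes finitely many values, and by independence and uniformity each cylinder has
    probability #|A|^-n, so the integral is a finite sum. *)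
Lemma expectation_word_mean (g : seq Y -> R) :
  ('E_P[fun t => g (D t)])%E = (word_mean n (fun w : seq A => g (map val w)))%:E.
Proof.
rewrite unlock word_mean_tuple.
transitivity (\int[P]_t (\sum_(w : n.-tuple A) (g (map val w))%:E * (\1_(cylinder w) t)%:E))%E.
  apply: eq_integral => t _.
  have [w wD] := digits_in_alphabet t.
  rewrite (bigD1 w)//= big1 ?adde0 => [|v vw]; last first.
    rewrite indicE (_ : t \in cylinder v = false) ?mule0//; apply/negbTE.
    apply: contraNN vw => /set_mem; rewrite /cylinder/= wD => e.
    apply/eqP/val_inj/(inj_map val_inj); by have := congr1 val e.
  by rewrite indicE mem_set// mule1 wD.
rewrite integral_sum//=; last first.
  by move=> w; apply: integrableZl => //; exact: integrable_indic.
rewrite -sumEFin; apply: eq_bigr => w _.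
rewrite integralZl//; last exact: integrable_indic.
by rewrite integral_indic// setIT EFinM; congr (_ * _)%E; exact: probability_cylinder.
Qed.

Lemma variance_word_mean (g : seq Y -> R) : let W (w : seq A) := g (map val w) in
  ('V_P[fun t => g (D t)])%E = (word_mean n (fun w => (W w - word_mean n W) ^+ 2))%:E.
Proof.
move=> W; rewrite /variance unlock expectation_word_mean /=.
rewrite -(expectation_word_mean (fun v => (g v - word_mean n W) ^+ 2)).
by congr expectation; apply/funext => t; rewrite /= expr2.
Qed.

Lemma probability_word_mean (g : seq Y -> R) (x : R) :
  P ((fun t => g (D t)) @^-1` `]-oo, x]) =
  (word_mean n (fun w : seq A => (g (map val w) <= x)%R%:R))%:E.
Proof.
rewrite -(expectation_word_mean (fun v => (g v <= x)%R%:R)).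
rewrite -expectation_indic.
  congr expectation; apply/funext => t; rewrite indicE; congr (_%:R).
  by apply: congr1; apply/idP/idP => [/set_mem|h]; [|apply/mem_set]; rewrite /= in_itv.
rewrite (_ : _ @^-1` _ = \bigcup_(w in [set w : n.-tuple A | g (map val w) <= x]) cylinder w).
  by apply: fin_bigcup_measurable => // w _; exact: measurable_cylinder.
apply/seteqP; split=> t /=; rewrite in_itv/=.
  have [w wD] := digits_in_alphabet t; rewrite wD => gx.
  by exists w.
by move=> [w gx ->].
Qed.

End Transfer.

Theorem theorem4p7 (R : realType) (tau : algC) (d : nat)
    (DD AI : {fset 'rV[algC]_d})
    (disp : nat -> measure_display) (T : forall n, measurableType (disp n))
    (P : forall n, probability (T n) R)
    (D : forall n, T n -> n.-tuple 'rV[algC]_d) :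
  tau \in Aint -> (0 < d)%N ->
  [set` DD] `<=` @Zadjv tau d ->
  [set` DD] `&` [set tau *: y | y in @Zadjv tau d] = [set 0] ->
  (forall z, Zadjv tau z -> exists b, representation tau DD z b) ->
  (forall c, Zadjv tau c -> exists U : R, forall z, Zadjv tau z ->
     `|(mw tau DD (z + c))%:R - (mw tau DD z)%:R| <= U) ->
  [set` AI] `<=` @Zadjv tau d ->
  (1 < #|` AI|)%N -> 0 \in AI -> irredundant tau AI ->
  (forall n, iid_uniform_digits (P n) AI (D n)) ->
  let W n (t : T n) : R := (mw tau DD (value tau (D n t)))%:R in
  exists E V : R,
    [/\ V != 0,
        (fun n => fine 'E_(P n)[W n] - E * n%:R) =O_\oo (fun=> 1 : R^o),
        (fun n => fine 'V_(P n)[W n] - V * n%:R) =O_\oo (fun=> 1 : R^o)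
      & converges_in_distribution P
          (fun n t => (W n t - E * n%:R) / Num.sqrt (V * n%:R))
          (normal_prob 0 1)].
Proof.
move=> tau_int d0 DZ DI Drep Dshift AZ A2 A0 Airr Diid W.
have DD0 : 0 \in DD by have : ([set 0] : set 'rV[algC]_d) 0 by []; rewrite -DI => -[].
have Dnd x y : x \in DD -> Zadjv tau y -> x = tau *: y -> x = 0.
  move=> xD yZ xy; suff : ([set 0] : set 'rV[algC]_d) x by [].
  by rewrite -DI; split => //; exists y.
have [a aA a0] : exists2 a, a \in AI & a != 0.
  apply/not_exists2P => H.
  have : (AI `<=` [fset 0])%fset.
    by apply/fsubsetP => x xA; rewrite inE; have [//|/negP/negPn] := H x.
  by move/fsubset_leq_card; rewrite cardfs1 leqNgt A2.
(* For tau = 0 the sequences [[:: 0]] and [[:: 0; a]] would both represent 0, against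
   irredundancy. *)
have tau0 : tau != 0.
  apply/eqP => t0.
  have r0 : representation tau AI 0 [:: 0].
    by split; [move=> x; rewrite inE => /eqP -> | rewrite value_cons value_nil scaler0 addr0].
  have ra : representation tau AI 0 [:: 0; a].
    split; last by rewrite value_cons t0 scale0r addr0.
    by move=> x; rewrite !inE => /orP[] /eqP ->.
  have /= e := Airr _ _ _ (@Zadjv0 tau d) r0 ra 1%N.
  by move: a0; rewrite -e eqxx.
have nonunit := nondivisible_nonunit d0 DZ Dnd Drep.
have [C [s [C0 CZ Cs Ccarry]]] := carry_set_exists tau_int d0 DZ Dnd Drep AZ.
(* The shift hypothesis gives one real bound for each carry; rounding up and taking the maximum over
   the finite list yields a uniform [U]. *)
have [||U HU] := @seq_nat_bound _ s (fun c m => C c -> forall z, Zadjv tau z ->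
   (mw tau DD (z + c) <= mw tau DD z + m)%N /\ (mw tau DD z <= mw tau DD (z + c) + m)%N).
- move=> c m n mn H Cc z zZ; have [h1 h2] := H Cc z zZ; split.
    by apply: leq_trans h1 _; rewrite leq_add2l.
  by apply: leq_trans h2 _; rewrite leq_add2l.
- move=> c _; have [Cc|nC] := pselect (C c); last by exists 0%N.
  have [u Hu] := Dshift c (CZ _ Cc); exists (Num.bound `|u|) => _ z zZ.
  have uB : u <= (Num.bound `|u|)%:R.
    by apply: le_trans (ler_norm u) _; rewrite ltW// archi_boundP.
  have := le_trans (Hu z zZ) uB; rewrite ler_distl lerBlDr -!natrD !ler_nat.
  by case/andP.
have Cshift c z (Cc : C c) := HU c (Cs c Cc) Cc z.
(* Words are taken over the finite type of elements of [AI], the alphabet for which the results on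
   word means are stated. *)
pose w (u : seq AI) : R := (mw tau DD (value tau (map val u)))%:R.
have sub (u : seq AI) : {subset map val u <= AI} by move=> _ /mapP[x _ ->]; exact: valP.
have valZ (u : seq AI) : Zadjv tau (value tau (map val u)) := Zadjv_value AZ (sub u).
have wD u v : `|w (u ++ v) - w u - w v| <= (U + U)%:R.
  have [h1 h2] := mw_shift_quasi_additive DZ Drep DD0 AZ C0 Ccarry Cshift (sub u) (valZ v).
  rewrite /w map_cat value_cat; move: h1 h2; rewrite -!(ler_nat R) !natrD => h1 h2.
  have U0 : 0 <= U%:R :> R by [].
  by rewrite ler_norml; apply/andP; split; lra.
have [M HM] := mw_separator DZ Drep DD0 AZ C0 CZ Cs Ccarry Cshift A0 tau0 nonunit Dnd.
pose z : AI := [` A0]%fset; pose a' : AI := [` aA]%fset.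
have wM u v : w (u ++ nseq M z ++ v) = w u + w v.
  rewrite /w -natrD -HM//; congr (mw _ _ _)%:R.
  by rewrite !map_cat map_nseq !value_cat value_zeros add0r size_nseq scalerA -exprD.
have w_zero m : w (nseq m z) = 0 by rewrite /w map_nseq value_zeros mw0.
have w_nil : w [::] = 0 := w_zero 0%N.
have w_ge0 u : 0 <= w u by rewrite ler0n.
have w_digit : 1 <= w [:: a'].
  rewrite ler1n /= value_cons value_nil scaler0 addr0; apply: (mw_gt0 Drep) => //.
  exact: AZ.
have cardA : (0 < #|{: AI}|)%N by apply/card_gt0P; exists z.
have [E HE] := mean_linear cardA wD.
have [V [K2 HV]] := var_linear cardA w_nil wD wM.
have V0 : 0 < V := var_slope_gt0 cardA w_ge0 wD wM w_zero w_digit HV.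
have [C4 C40 HC4] := fourth_moment_bound cardA w_nil wD wM.
have bigO1 (f : nat -> R) (k : R) : (forall n, `|f n| <= k) -> f =O_\oo (fun=> 1 : R^o).
  move=> fk; apply/eqO_exP; exists (`|k| + 1); first by rewrite ltr_wpDl.
  by apply: nearW => n; rewrite normr1 mulr1; apply: le_trans (fk n) _; have := ler_norm k; lra.
exists E, V; split.
- by rewrite gt_eqF.
- apply: (bigO1 _ (U + U)%:R) => n.
  by rewrite /W (expectation_word_mean (Diid n) (fun b => (mw tau DD (value tau b))%:R)); exact: HE.
- apply: (bigO1 _ K2) => n.
  by rewrite /W (variance_word_mean (Diid n) (fun b => (mw tau DD (value tau b))%:R)); exact: HV.
- move=> x _; suff : P n ((fun t => (W n t - E * n%:R) / Num.sqrt (V * n%:R)) @^-1` `]-oo, x])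
      @[n --> \oo] --> (gauss_cdf x)%:E by rewrite -gauss_cdfE.
  have PE n := probability_word_mean (Diid n)
    (fun b => ((mw tau DD (value tau b))%:R - E * n%:R) / Num.sqrt (V * n%:R)) x.
  under eq_cvg do rewrite PE.
  apply: cvg_EFin; first by apply: nearW.
  apply/cvgrPdist_le => e e0.
  have [n0 Hn0] := word_clt cardA w_nil wD HE V0 HV HC4 x e0.
  by exists n0 => // n /= nn0; rewrite distrC; exact: Hn0.
Qed.
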